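(* Let $C, D, t_0 \in \mathbb{C}$ be arbitrary, let $b\in\mathbb{C}$ with $|b|=1$, let $\eta=\log(b(t-t_0))$ (principal branch), and let $P_m, Q_m, R_m$ be the polynomials (depending on $D$) defined in the context. Then there exists $r>0$ (in general depending on $C$ and $D$) such that the psi series $$x(t)=\sum_{m=-1}^{\infty}P_m(\eta+C)(t-t_0)^m,\quad y(t)=\sum_{m=-2}^{\infty}Q_m(\eta+C)(t-t_0)^m,\quad z(t)=\sum_{m=-2}^{\infty}R_m(\eta+C)(t-t_0)^m$$ converge and satisfy the Lorenz system $$\frac{dx}{dt}=10(y-x),\qquad \frac{dy}{dt}=28x-y-xz,\qquad \frac{dz}{dt}=-\tfrac{8}{3}z+xy$$ in the disc $|t-t_0|\le r$ with the singular point $t=t_0$ and the branch cut $\{t_0-\bar b p : p\ge 0\}$ deleted. The same holds for the other choice of coefficients, obtained by changing the signs of all the $P_m$ and $Q_m$ and leaving the $R_m$ unchanged.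
   Context: Throughout, $\log$ is the principal branch. Fix $D\in\mathbb{C}$. Polynomials $P_m$ ($m\ge -1$), $Q_m$, $R_m$ ($m\ge -2$) in one variable $u$ (to be evaluated at $u=\eta+C$) are defined as follows. Initial values: $Q_{-2}=-\frac{i}{5}$, $R_{-2}=-\frac15$; $P_{-1}=2i$, $Q_{-1}=2i$, $R_{-1}=\frac{17}{9}$; $P_0=\frac{71}{9}i$, $Q_0=-\frac{349}{81}i-\frac{988}{81}iu$, $R_0=\frac{1385}{54}-\frac{988}{81}u$; $P_1=-\frac{9880}{81}iu$, $Q_1=-\frac{25991}{108}i+\frac{64220}{243}iu$, $R_1=-\frac{211189}{972}+\frac{167960}{729}u$; $P_2=-\frac{2108195}{972}i+\frac{469300}{243}iu$, $Q_2=\frac{3}{10}iD-\frac{477319147}{131220}i-\frac{167831753}{65610}iu-\frac{273676}{2187}iu^2$, $R_2=-\frac15D+\frac{138959125}{17496}-\frac{58846039}{32805}u-\frac{1444456}{2187}u^2$; $P_3=iD-\frac{96356411}{6561}iu-\frac{2736760}{6561}iu^2$. For $m\ge 3$, the triple $X_m=(P_{m+1},Q_m,R_m)^T$ is defined recursively by $$X_m=-\sum_{j=0}^{\lfloor (m+2)/2\rfloor}A_m^{-j-1}\frac{d^jF_m}{du^j},$$ where $$A_m=\begin{pmatrix}-m-1&10&0\\ \frac15&-m&-2i\\ -\frac i5&2i&-m\end{pmatrix},\qquad F_m=\begin{pmatrix}-10P_m\\ 28P_{m-1}-Q_{m-1}-\sum_{j=0}^mP_jR_{m-j-1}\\ -\frac83R_{m-1}+\sum_{j=0}^mP_jQ_{m-j-1}\end{pmatrix}.$$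 ($A_m$ has eigenvalues $-m+2,-m,-m-3$, so it is invertible for $m\ge3$; $X_m$ is the polynomial solution of $X_m'=A_mX_m+F_m$.) *)

(* Defs.v *)
From HB Require Import structures.
From mathcomp Require Import all_boot all_order all_algebra.
From mathcomp Require Import all_classical all_reals all_analysis.
From mathcomp Require Import complex.
From mathcomp Require Import zify.

Set Implicit Arguments.
Unset Strict Implicit.
Unset Printing Implicit Defensive.

Import Order.TTheory GRing.Theory Num.Theory.
Import numFieldNormedType.Exports.

Local Open Scope classical_set_scope.
Local Open Scope ring_scope.

(* Literals above 5000 are parsed as abstract [Nat.of_num_uint] terms; reducing
   them (e.g. by conversion in [done]) builds huge unary numbers, hence the lock
   and the [simpl never]. *)
HB.lock Definition frac {R : realType} (p q : nat) : R[i] := p%:R / q%:R.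
#[global] Arguments Nat.of_num_uint : simpl never.

(* The argument in ]-pi, pi] of z != 0, and the principal logarithm. *)
Definition carg {R : realType} (z : R[i]) : R :=
  let a := acos (complex.Re z / Normc.normc z) in
  if 0 <= complex.Im z then a else - a.

Definition clog {R : realType} (z : R[i]) : R[i] :=
  Complex (ln (Normc.normc z)) (carg z).

(* Families of polynomials are indexed by all of int; only P_m (m >= -1) and
   Q_m, R_m (m >= -2) are meaningful, the other values being 0. *)
Record coeffs (R : realType) := Coeffs {
  coefP : int -> {poly R[i]};
  coefQ : int -> {poly R[i]};
  coefR : int -> {poly R[i]} }.

Section Coefficients.
Context {R : realType}.
Variable D : R[i].
Local Notation I := ('i%C : R[i]).

(* [Negz n] is - n.+1. *)
Definition initP (m : int) : {poly R[i]} :=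
  match m with
  | Negz 0 => I *: 2%:P
  | Posz 0 => I *: (frac 71 9)%:P
  | Posz 1 => I *: (- frac 9880 81 *: 'X)
  | Posz 2 => I *: (- (frac 2108195 972)%:P + frac 469300 243 *: 'X)
  | Posz 3 => I *: (D%:P - frac 96356411 6561 *: 'X - frac 2736760 6561 *: 'X^2)
  | _ => 0
  end.

Definition initQ (m : int) : {poly R[i]} :=
  match m with
  | Negz 1 => I *: (- frac 1 5)%:P
  | Negz 0 => I *: 2%:P
  | Posz 0 => I *: (- (frac 349 81)%:P - frac 988 81 *: 'X)
  | Posz 1 => I *: (- (frac 25991 108)%:P + frac 64220 243 *: 'X)
  | Posz 2 => I *: ((frac 3 10 * D)%:P - (frac 477319147 131220)%:P
                    - frac 167831753 65610 *: 'X - frac 273676 2187 *: 'X^2)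
  | _ => 0
  end.

Definition initR (m : int) : {poly R[i]} :=
  match m with
  | Negz 1 => (- frac 1 5)%:P
  | Negz 0 => (frac 17 9)%:P
  | Posz 0 => (frac 1385 54)%:P - frac 988 81 *: 'X
  | Posz 1 => - (frac 211189 972)%:P + frac 167960 729 *: 'X
  | Posz 2 => - (frac 1 5 * D)%:P + (frac 138959125 17496)%:P
              - frac 58846039 32805 *: 'X - frac 1444456 2187 *: 'X^2
  | _ => 0
  end.

Definition mxA (m : nat) : 'M[R[i]]_3 := \matrix_(i, j)
  (nth [::]
    [:: [:: - m%:R - 1; 10   ; 0      ];
        [:: 1 / 5     ; - m%:R; - 2 * I];
        [:: - (I / 5) ; 2 * I; - m%:R ]] i)`_j.

Definition colF (c : coeffs R) (m : nat) : 'cV[{poly R[i]}]_3 := \col_i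
  [:: - 10 * coefP c m;
      28 * coefP c (m%:Z - 1) - coefQ c (m%:Z - 1)
        - \sum_(0 <= j < m.+1) coefP c j * coefR c (m%:Z - j%:Z - 1);
      - (8 / 3) *: coefR c (m%:Z - 1)
        + \sum_(0 <= j < m.+1) coefP c j * coefQ c (m%:Z - j%:Z - 1)]`_i.

Definition colX (c : coeffs R) (m : nat) : 'cV[{poly R[i]}]_3 :=
  - \sum_(0 <= j < ((m + 2) %/ 2).+1)
      map_mx polyC (mxA m ^- j.+1) *m map_mx (fun p => p^`(j)) (colF c m).

Definition update (f : int -> {poly R[i]}) (m : int) (p : {poly R[i]}) :=
  fun k => if k == m then p else f k.

Definition extend (c : coeffs R) (m : nat) : coeffs R :=
  let X := colX c m in
  Coeffs (update (coefP c) (m%:Z + 1) (X 0 0))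
         (update (coefQ c) m (X 1 0))
         (update (coefR c) m (X 2 0)).

(* After n steps P is known up to index n + 3, and Q, R up to n + 2. *)
Fixpoint coeffs_upto (n : nat) : coeffs R :=
  if n is k.+1 then extend (coeffs_upto k) (k + 3)
  else Coeffs initP initQ initR.

Definition psiP (m : int) := coefP (coeffs_upto `|m|) m.
Definition psiQ (m : int) := coefQ (coeffs_upto `|m|) m.
Definition psiR (m : int) := coefR (coeffs_upto `|m|) m.

Definition psi_coeffs : coeffs R := Coeffs psiP psiQ psiR.

Lemma coeffs_upto_stable n k :
  [/\ forall m, m <= n%:Z + 3 ->
        coefP (coeffs_upto (n + k)) m = coefP (coeffs_upto n) m,
      forall m, m <= n%:Z + 2 ->
        coefQ (coeffs_upto (n + k)) m = coefQ (coeffs_upto n) m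
    & forall m, m <= n%:Z + 2 ->
        coefR (coeffs_upto (n + k)) m = coefR (coeffs_upto n) m].
Proof.
elim: k => [|k [IHP IHQ IHR]]; first by rewrite addn0.
rewrite addnS /=; split=> m mn; rewrite /update ifF ?IHP ?IHQ ?IHR //;
  by apply/negbTE; rewrite neq_lt (le_lt_trans mn) //; lia.
Qed.

Lemma psi_coeffsE n :
  [/\ forall m, m <= n%:Z + 3 -> psiP m = coefP (coeffs_upto n) m,
      forall m, m <= n%:Z + 2 -> psiQ m = coefQ (coeffs_upto n) m
    & forall m, m <= n%:Z + 2 -> psiR m = coefR (coeffs_upto n) m].
Proof.
have [n1 n2] : (forall m : nat, n <= maxn n m)%N /\
    (forall m : nat, m <= maxn n m)%N by split=> m; lia.
by split=> m mn; rewrite /psiP /psiQ /psiR;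
  [have [+ _ _] := coeffs_upto_stable `|m| (maxn n `|m| - `|m|);
   have [+ _ _] := coeffs_upto_stable n (maxn n `|m| - n)
  |have [_ + _] := coeffs_upto_stable `|m| (maxn n `|m| - `|m|);
   have [_ + _] := coeffs_upto_stable n (maxn n `|m| - n)
  |have [_ _ +] := coeffs_upto_stable `|m| (maxn n `|m| - `|m|);
   have [_ _ +] := coeffs_upto_stable n (maxn n `|m| - n)];
  rewrite !subnKC // => <- // <- //; lia.
Qed.

Lemma psi_coeffs_rec (m : nat) : (3 <= m)%N ->
  [/\ psiP (m%:Z + 1) = colX psi_coeffs m 0 0,
      psiQ m = colX psi_coeffs m 1 0 &
      psiR m = colX psi_coeffs m 2 0].
Proof.
move=> m3; have [k mk] : exists k, m = (k + 3)%N by exists (m - 3)%N; lia.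
have [EP EQ ER] := psi_coeffsE k.
have -> : colX psi_coeffs m = colX (coeffs_upto k) m.
  congr (- _); apply: eq_bigr => j _; congr (_ *m map_mx _ _).
  apply/matrixP => i i'; rewrite !mxE /= EP ?EQ ?ER; try lia.
  congr (nth 0 [:: _; _ - _; _ + _] i); first by rewrite EP //; lia.
    by apply: eq_big_nat => l /andP[_ lm]; rewrite EP ?ER //; lia.
  by apply: eq_big_nat => l /andP[_ lm]; rewrite EP ?EQ //; lia.
have {EP EQ ER} [EP EQ ER] := psi_coeffsE k.+1.
by rewrite EP ?EQ ?ER; try lia; rewrite /= /update -mk !eqxx.
Qed.

End Coefficients.

Section PsiSeries.
Context {R : realType}.

(* R[i]^o is R[i] as a normed module over itself, so that convergence and
   derivatives below are the complex ones. *)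
Definition psi_terms (A : int -> {poly R[i]}) (m0 : int) (u s : R[i]) :
  (R[i]^o) ^nat := fun n => (A (m0 + n%:Z)).[u] * s ^ (m0 + n%:Z).

Definition psi_cvg (A : int -> {poly R[i]}) (m0 : int) (u s : R[i]) : Prop :=
  cvgn (series (psi_terms A m0 u s)).

Definition psi_sum (A : int -> {poly R[i]}) (m0 : int) (u s : R[i]) : R[i]^o :=
  limn (series (psi_terms A m0 u s)).

Definition lorenz_on (S : set R[i]) (x y z : R[i]^o -> R[i]^o) : Prop :=
  forall t : R[i]^o, S t ->
  [/\ is_derive t (1 : R[i]^o) x (10 * (y t - x t)),
      is_derive t (1 : R[i]^o) y (28 * x t - y t - x t * z t) &
      is_derive t (1 : R[i]^o) z (- (8 / 3) * z t + x t * y t)].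

Definition slit_disc (t0 b : R[i]) (r : R) : set R[i] :=
  [set t | `|t - t0| <= r%:C%C] `\` [set t0]
    `\` [set t0 - b^*%C * p%:C%C | p in [set p : R | 0 <= p]].

Definition psi_lorenz (C t0 b : R[i]) (r : R) (c : coeffs R) : Prop :=
  let eta t := clog (b * (t - t0)) in
  let S := slit_disc t0 b r in
  [/\ forall t, S t -> psi_cvg (coefP c) (-1) (eta t + C) (t - t0),
      forall t, S t -> psi_cvg (coefQ c) (-2) (eta t + C) (t - t0),
      forall t, S t -> psi_cvg (coefR c) (-2) (eta t + C) (t - t0) &
      lorenz_on S
        (fun t => psi_sum (coefP c) (-1) (eta t + C) (t - t0))
        (fun t => psi_sum (coefQ c) (-2) (eta t + C) (t - t0))
        (fun t => psi_sum (coefR c) (-2) (eta t + C) (t - t0))].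

Definition flip_sign (c : coeffs R) : coeffs R :=
  Coeffs (fun m => - coefP c m) (fun m => - coefQ c m) (coefR c).

End PsiSeries.

(* Main.v *)
(* The recursion forces [X_m' = A_m X_m + F_m], so the psi series solve the system term by
   term. Growth: write [A_m = B - m]; in the norm [sum_k |a_k| 4 ^ k] on polynomials, [d/du]
   costs at most [m / 8 + O(1)] on [X_m], whose degree is at most [m / 2 + 1], so that
   [m X_m = B X_m - X_m' + F_m] gives [m |X_m| <= 2 |F_m|] up to a constant factor once m is
   large. As [F_m] is quadratic in the earlier terms, [|X_m| <= M K ^ m] by induction, and at
   [u = eta + C] this costs a further factor [(1 + |u|) ^ m], harmless because
   [|t - t_0| log |t - t_0|] tends to 0. Termwise differentiation: along
   the line [(u + al x, s + be x)] a term [p(u) s ^ n] is a polynomial in x whose remainder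
   of order 2 is controlled by its absolute-value majorant on a slightly larger disc. *)

(* The matrix is singular at [m = 2], and [D] enters there as the multiple of a kernel vector. The
   recursion can therefore only start at [m = 3], and the five lowest orders are checked by direct
   computation with [D] left free. Part of [B] comes from the two end terms of each convolution,
   which multiply the unknown [X_m] by leading constants; they have to be absorbed on the left
   instead of being estimated inductively. The factor [m] on the left pays for the number of
   products that remain, so a plain geometric bound is stable under the induction. At degree about
   [m / 2] any weight above 1/2 would leave a positive multiple of [m] there; the weight 4 leaves
   [7 / 8]. Since [eta] is unbounded near [t_0], a bound on a fixed disc of [u] would not do; in a
   coefficient norm the weight can grow with the logarithm. The estimates see [t_0] and [b] only
   through [|t - t_0|] and [|b| = 1], so one radius serves all of them. *)
Require Import Defs.
From mathcomp Require Import all_boot all_order all_algebra.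
From mathcomp Require Import all_classical all_reals all_analysis.
From mathcomp Require Import complex.
From mathcomp Require Import ring lra zify.
Set Implicit Arguments.
Unset Strict Implicit.
Unset Printing Implicit Defensive.
Import Order.TTheory GRing.Theory Num.Theory.
Import numFieldNormedType.Exports.
Local Open Scope ring_scope.

(** * A majorant norm on complex polynomials *)

Section Norms.
Context {R : realType}.
Implicit Types (p q : {poly R[i]}) (w rho : R) (z u : R[i]).
Local Notation nm := (@Normc.normc R).

Lemma normcE_normc z : `|z| = (nm z)%:C%C.
Proof. by rewrite normc_def; case: z. Qed.

Lemma normc_ge0 z : 0 <= nm z.
Proof. by case: z => x y; rewrite /= sqrtr_ge0. Qed.

Lemma normc_gt0 z : (0 < nm z) = (z != 0).
Proof.
rewrite lt_neqAle normc_ge0 andbT eq_sym; apply/idP/idP; apply: contraNneq.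
  by move=> ->; rewrite Normc.normc0.
by move=> /Normc.eq0_normc ->.
Qed.

Lemma normcX z n : nm (z ^+ n) = nm z ^+ n.
Proof.
by elim: n => [|n IH]; rewrite ?expr0 ?Normc.normc1 // !exprS Normc.normcM IH.
Qed.

Lemma normc_real (x : R) : nm x%:C%C = `|x|.
Proof. by rewrite /= expr0n addr0 sqrtr_sqr. Qed.

Lemma normc_natr n : nm n%:R = n%:R.
Proof. by rewrite -(rmorph_nat (real_complex R)) normc_real ger0_norm. Qed.

Lemma normc_sum (I : Type) (s : seq I) (F : I -> R[i]) :
  nm (\sum_(i <- s) F i) <= \sum_(i <- s) nm (F i).
Proof.
elim: s => [|i s IH]; first by rewrite !big_nil Normc.normc0.
by rewrite !big_cons; apply: le_trans (le_normcD _ _) _; rewrite lerD2l.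
Qed.

Lemma normcB z u : nm (z - u) = nm (u - z).
Proof. by rewrite -normcN opprB. Qed.

Lemma le_normcB z u : nm (z - u) <= nm z + nm u.
Proof. by rewrite -(normcN u) le_normcD. Qed.

(** The weight varies: it is 4 in the growth estimate, the radius of a disc containing [u] in the
    convergence estimates, and [rho] for polynomials along a line. Submultiplicativity and
    domination of the values on the disc of radius [w] replace suprema. *)
Definition pnorm w p : R := (map_poly nm p).[w].

Lemma coef_map_normc p k : (map_poly nm p)`_k = nm p`_k.
Proof. by rewrite coef_map_id0 // Normc.normc0. Qed.

Lemma ler_horner (P Q : {poly R}) w : 0 <= w ->
  (forall k, P`_k <= Q`_k) -> P.[w] <= Q.[w].
Proof.
move=> w0 PQ; rewrite (horner_coef_wide _ (leq_maxl (size P) (size Q))).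
rewrite (horner_coef_wide _ (leq_maxr (size P) (size Q))).
by apply: ler_sum => k _; rewrite ler_wpM2r ?exprn_ge0.
Qed.

Lemma pnormE w p n : (size p <= n)%N ->
  pnorm w p = \sum_(k < n) nm p`_k * w ^+ k.
Proof.
move=> pn; rewrite /pnorm (@horner_coef_wide _ n).
  by apply: eq_bigr => k _; rewrite coef_map_normc.
by rewrite (leq_trans _ pn)// size_poly.
Qed.

Lemma pnorm_ge0 w p : 0 <= w -> 0 <= pnorm w p.
Proof.
by move=> w0; rewrite (pnormE _ (leqnn _)) sumr_ge0 // => k _;
  rewrite mulr_ge0 ?exprn_ge0 ?normc_ge0.
Qed.

Lemma pnormD w p q : 0 <= w -> pnorm w (p + q) <= pnorm w p + pnorm w q.
Proof.
by move=> w0; rewrite /pnorm -hornerD; apply: ler_horner => // k;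
  rewrite coefD !coef_map_normc coefD le_normcD.
Qed.

Lemma pnormN w p : pnorm w (- p) = pnorm w p.
Proof.
by congr horner; apply/polyP => k; rewrite !coef_map_normc coefN normcN.
Qed.

Lemma pnormZ w z p : pnorm w (z *: p) = nm z * pnorm w p.
Proof.
rewrite /pnorm -hornerZ; congr horner; apply/polyP => k.
by rewrite coefZ !coef_map_normc coefZ Normc.normcM.
Qed.

Lemma pnormC w z : pnorm w z%:P = nm z.
Proof.
by rewrite (pnormE _ (size_polyC_leq1 _)) big_ord1 coefC eqxx mulr1.
Qed.

Lemma pnorm0 w : pnorm w 0 = 0.
Proof. by rewrite -[0]/(0%:P) pnormC Normc.normc0. Qed.

Lemma pnormM w p q : 0 <= w -> pnorm w (p * q) <= pnorm w p * pnorm w q.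
Proof.
move=> w0; rewrite /pnorm -hornerM; apply: ler_horner => // k.
rewrite coef_map_normc !coefM; apply: le_trans (normc_sum _ _) _.
by apply: ler_sum => i _; rewrite !coef_map_normc Normc.normcM.
Qed.

Lemma pnormMXaddC w p z : pnorm w (p * 'X + z%:P) = pnorm w p * w + nm z.
Proof.
have -> : pnorm w p * w + nm z = (map_poly nm p * 'X + (nm z)%:P).[w].
  by rewrite hornerMXaddC.
congr horner; apply/polyP => k; rewrite coef_map_normc !coefD !coefMX !coefC.
by rewrite coef_map_normc; case: k => [|k] /=; rewrite ?add0r ?addr0.
Qed.

Lemma pnormX w p n : 0 <= w -> pnorm w (p ^+ n) <= pnorm w p ^+ n.
Proof.
move=> w0; elim: n => [|n IH]; first by rewrite !expr0 -[1]/(1%:P) pnormC Normc.normc1.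
rewrite !exprS; apply: le_trans (pnormM _ _ w0) _.
by rewrite ler_wpM2l ?pnorm_ge0.
Qed.

Lemma pnorm_sum w (I : Type) (s : seq I) (F : I -> {poly R[i]}) : 0 <= w ->
  pnorm w (\sum_(i <- s) F i) <= \sum_(i <- s) pnorm w (F i).
Proof.
move=> w0; elim: s => [|i s IH]; first by rewrite !big_nil pnorm0.
by rewrite !big_cons; apply: le_trans (pnormD _ _ w0) _; rewrite lerD2l.
Qed.

Lemma le_pnorm w1 w2 p : 0 <= w1 -> w1 <= w2 -> pnorm w1 p <= pnorm w2 p.
Proof.
move=> w0 w12; rewrite !(pnormE _ (leqnn _)); apply: ler_sum => k _.
by rewrite ler_wpM2l ?normc_ge0 // lerXn2r // nnegrE // (le_trans w0).
Qed.

Lemma pnorm_horner p u : nm p.[u] <= pnorm (nm u) p.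
Proof.
rewrite horner_coef (pnormE _ (leqnn _)); apply: le_trans (normc_sum _ _) _.
by apply: ler_sum => k _; rewrite Normc.normcM normcX.
Qed.

(** Horner's scheme: each step multiplies by [q], whose norm thus becomes the new weight. *)
Lemma pnorm_comp w p q : 0 <= w -> pnorm w (p \Po q) <= pnorm (pnorm w q) p.
Proof.
move=> w0; elim/poly_ind: p => [|p c IH]; first by rewrite comp_poly0 !pnorm0.
rewrite comp_poly_MXaddC pnormMXaddC; apply: le_trans (pnormD _ _ w0) _.
rewrite pnormC lerD2r; apply: le_trans (pnormM _ _ w0) _.
by rewrite ler_wpM2r ?pnorm_ge0.
Qed.

(** A term of degree [k <= n] gains the factor [k] and loses one power of [w]. *)
Lemma pnorm_deriv w p n : 0 < w -> (size p <= n.+1)%N ->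
  pnorm w p^`() <= n%:R / w * pnorm w p.
Proof.
move=> w0 pn; rewrite (pnormE _ pn) (@pnormE _ _ n); last first.
  have [->|p0] := eqVneq p 0; first by rewrite linear0 size_poly0.
  by rewrite -ltnS (leq_trans (lt_size_deriv p0)).
rewrite big_ord_recl /= mulrDr mulr_sumr.
rewrite -[leLHS]add0r lerD //.
  by rewrite !mulr_ge0 ?invr_ge0 ?normc_ge0 // ltW.
apply: ler_sum => k _; rewrite coef_deriv normcMn -mulr_natl ?add1n.
rewrite ?lift0 exprS !mulrA -subr_ge0.
rewrite [X in 0 <= X](_ : _ = (n%:R - k.+1%:R) * (nm p`_k.+1 * w ^+ k)).
  2: by rewrite /bump /= ?add1n; field; rewrite gt_eqF.
by rewrite mulr_ge0 ?subr_ge0 ?ler_nat // mulr_ge0 ?normc_ge0 ?exprn_ge0 ?ltW.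
Qed.

(** Only powers up to [n] gain from the larger weight. This carries the bound at weight 4 over to
    arguments [u] of logarithmic size. *)
Lemma pnorm_scale w L p n : 0 <= w -> 1 <= L -> (size p <= n.+1)%N ->
  pnorm (w * L) p <= L ^+ n * pnorm w p.
Proof.
move=> w0 L1 pn; rewrite !(pnormE _ pn) mulr_sumr; apply: ler_sum => k _.
rewrite exprMn mulrA mulrC ler_wpM2r ?mulr_ge0 ?normc_ge0 ?exprn_ge0//.
by rewrite ler_weXn2l // -ltnS.
Qed.

Lemma pnorm_coef rho p k : 0 <= rho -> nm p`_k * rho ^+ k <= pnorm rho p.
Proof.
move=> r0; rewrite (pnormE rho (leq_maxl (size p) k.+1)).
have kn : (k < maxn (size p) k.+1)%N by rewrite leq_max leqnn orbT.
rewrite (bigD1 (Ordinal kn)) //= lerDl sumr_ge0 // => i _.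
by rewrite mulr_ge0 ?normc_ge0 ?exprn_ge0.
Qed.

(* The Taylor terms of order [k >= 2] shrink by [(nm z / rho) ^+ k], hence at least
   quadratically. *)
Lemma pnorm_taylor rho p z : 0 < rho -> nm z <= rho ->
  nm (p.[z] - p.[0] - z * p^`().[0]) <= (nm z / rho) ^+ 2 * pnorm rho p.
Proof.
move=> r0 zr; have ps : (size p <= (size p).+2)%N by rewrite leqW.
rewrite !horner_coef0 coef_deriv mulr1n.
rewrite (horner_coef_wide _ ps) (pnormE _ ps) !big_ord_recl /= expr0 mulr1.
rewrite /bump /= !expr1 ?expr0.
set S := (X in _ + (_ + X) - _); set T := (X in _ * (_ + (_ + X))).
have -> : p`_0 + (p`_1 * z + S) - p`_0 - z * p`_1 = S by ring.
apply: (@le_trans _ _ ((nm z / rho) ^+ 2 * T)); last first.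
  rewrite ler_wpM2l ?exprn_ge0 ?divr_ge0 ?normc_ge0 ?(ltW r0) // addrA lerDr.
  by rewrite addr_ge0 ?mulr_ge0 ?normc_ge0 ?exprn_ge0 // ltW.
rewrite /S /T mulr_sumr; apply: le_trans (normc_sum _ _) _.
apply: ler_sum => k _; rewrite /bump !add1n Normc.normcM normcX.
rewrite [leRHS]mulrCA; apply: ler_wpM2l; first exact: normc_ge0.
have -> : nm z = nm z / rho * rho by rewrite divfK // gt_eqF.
rewrite mulfK ?gt_eqF //.
have a0 : 0 <= nm z / rho by rewrite divr_ge0 ?normc_ge0 ?ltW.
have a1 : nm z / rho <= 1 by rewrite ler_pdivrMr // mul1r.
rewrite exprMn ler_wpM2r ?exprn_ge0 ?(ltW r0) //.
by rewrite -[k.+2]add2n exprD ler_piMr ?exprn_ge0 // exprn_ile1.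
Qed.

End Norms.

(** * Geometrically bounded complex series *)

Section ComplexLimits.
Context {R : realType}.
Local Notation nm := (@Normc.normc R).
Local Open Scope classical_set_scope.

Lemma cvgc_normcP {T : Type} {F : set_system T} {FF : Filter F}
    (f : T -> R[i]^o) (l : R[i]^o) :
  f @ F --> l <-> forall e : R, 0 < e -> \forall t \near F, nm (l - f t) < e.
Proof.
rewrite cvgrPdist_lt; split=> H e e0.
  have /H : 0 < e%:C%C by rewrite ltcR.
  by apply: filterS => t; rewrite normcE_normc ltcR.
(* A positive element of [R[i]] is real, because the order requires equal imaginary parts. *)
move: e0; case: e => a b; rewrite ltcE /= => /andP[/eqP-> a0].
by apply: filterS (H _ a0) => t; rewrite normcE_normc ltcR.
Qed.

Lemma le_normc_ReIm (z : R[i]) : nm z <= `|complex.Re z| + `|complex.Im z|.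
Proof.
case: z => x y /=; rewrite -ler_sqr ?nnegrE ?sqrtr_ge0 ?addr_ge0 //.
rewrite sqr_sqrtr ?addr_ge0 ?sqr_ge0 // sqrrD !real_normK ?num_real //.
have: 0 <= `|x| * `|y| by rewrite mulr_ge0.
by move: (_ * _) => ?; rewrite mulr2n; lra.
Qed.

Lemma ge_normc_Re (z : R[i]) : `|complex.Re z| <= nm z.
Proof. by rewrite -lecR -normcE_normc normc_ge_Re. Qed.

Lemma ge_normc_Im (z : R[i]) : `|complex.Im z| <= nm z.
Proof.
by case: z => x y /=; rewrite -sqrtr_sqr ler_wsqrtr // lerDr sqr_ge0.
Qed.

Lemma cvg_geometric_bound (u : R ^nat) (A q : R) : 0 <= q < 1 ->
  (forall n, `|u n| <= A * q ^+ n) -> cvgn (series u).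
Proof.
move=> /andP[q0 q1] uA; apply: normed_cvg.
have h : cvgn (series (geometric A q)).
  by apply: is_cvg_geometric_series; rewrite ger0_norm.
apply: (series_le_cvg _ _ _ h) => //= n; first exact: le_trans (uA n).
Qed.

(** The ratio 1/8 leaves room for two factors [2 ^ n] in the Cauchy product, one for the length of a
    convolution and one for the number of neglected coefficients; the ratio 1/2 is left over. *)
Definition geo_bounded (A : R) (u : R[i] ^nat) :=
  forall n, nm (u n) <= A * (1 / 8) ^+ n.

Lemma series_ReIm (u : R[i] ^nat) n : series u n =
  Complex (series (fun n => complex.Re (u n)) n) (series (fun n => complex.Im (u n)) n).
Proof.
rewrite /series /=; elim: n => [|k IH]; first by rewrite !big_nil.
by rewrite !big_nat_recr //= IH; case: (u k).
Qed.

(** Real and imaginary parts are dominated by the geometric series; their limits are then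
    reassembled. *)
Lemma geo_bounded_cvg A u : geo_bounded A u -> cvgn (series u : (R[i]^o) ^nat).
Proof.
move=> uA; have q01 : 0 <= (1 / 8 : R) < 1 by lra.
have cRe : cvgn (series (fun n => complex.Re (u n))).
  by apply: (cvg_geometric_bound q01) => n; apply: le_trans (ge_normc_Re _) (uA n).
have cIm : cvgn (series (fun n => complex.Im (u n))).
  by apply: (cvg_geometric_bound q01) => n; apply: le_trans (ge_normc_Im _) (uA n).
apply/cvg_ex; exists (Complex (limn (series (fun n => complex.Re (u n))))
  (limn (series (fun n => complex.Im (u n))))).
apply/cvgc_normcP => e e0; have e2 : 0 < e / 2 by rewrite divr_gt0.
move/cvgrPdist_lt/(_ _ e2): cRe => cRe; move/cvgrPdist_lt/(_ _ e2): cIm => cIm.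
near=> n; apply: le_lt_trans (le_normc_ReIm _) _.
have -> : series u n = Complex (series (fun n => complex.Re (u n)) n)
    (series (fun n => complex.Im (u n)) n) by exact: series_ReIm.
rewrite /= [e]splitr ltrD //; [near: n; exact: cRe|near: n; exact: cIm].
Unshelve. all: by end_near. Qed.

Lemma geo_sum_le n : \sum_(k < n) (1 / 8 : R) ^+ k <= 2.
Proof.
(* The subtracted remainder makes the bound inductive. *)
suff : \sum_(k < n) (1 / 8 : R) ^+ k <= 2 - 2 * (1 / 8) ^+ n.
  by move/le_trans; apply; rewrite gerBl mulr_ge0 ?exprn_ge0 //; lra.
elim: n => [|n IH]; first by rewrite big_ord0 expr0; lra.
rewrite big_ord_recr /= exprS; have : 0 <= (1 / 8 : R) ^+ n by rewrite exprn_ge0 //; lra.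
by move: IH; set a := (1 / 8) ^+ n; lra.
Qed.

Lemma geo_bounded_lim A u (l : R[i]^o) : geo_bounded A u ->
  (series u : (R[i]^o) ^nat) @ \oo --> l -> nm l <= 2 * A.
Proof.
move=> uA ul; apply/ler_addgt0Pl => e e0.
have /filter_ex [n ln] : \forall n \near \oo, nm (l - series u n) < e.
  by move/cvgc_normcP: ul => /(_ _ e0).
rewrite -[l](subrK (series u n)); apply: le_trans (le_normcD _ _) _.
rewrite lerD ?(ltW ln) // /series /= big_mkord.
apply: le_trans (normc_sum _ _) _.
apply: (@le_trans _ _ (\sum_(k < n) A * (1 / 8) ^+ k)); first exact: ler_sum.
rewrite -mulr_sumr mulrC ler_wpM2r ?geo_sum_le //.
by apply: le_trans (normc_ge0 (u 0)) _; rewrite (le_trans (uA 0%N)) // expr0 mulr1.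
Qed.

Lemma geo_bounded_ge0 A u : geo_bounded A u -> 0 <= A.
Proof.
by move=> uA; apply: le_trans (normc_ge0 (u 0)) _; rewrite (le_trans (uA 0%N)) //
  expr0 mulr1.
Qed.

(* The product of the partial sums is the value at 1 of a product of polynomials, whose
   coefficients of order [k >= n] are at most [(k + 1) A B 8 ^ (- k)]. *)
Lemma cauchy_product A B (a b : R[i] ^nat) (la lb : R[i]^o) :
  geo_bounded A a -> geo_bounded B b ->
  (series a : (R[i]^o) ^nat) @ \oo --> la ->
  (series b : (R[i]^o) ^nat) @ \oo --> lb ->
  (series (fun n => \sum_(j < n.+1) a j * b (n - j)%N) : (R[i]^o) ^nat) @ \oo
    --> (la * lb : R[i]^o).
Proof.
move=> aA bB ala blb.
have A0 := geo_bounded_ge0 aA; have B0 := geo_bounded_ge0 bB.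
set c := fun n => \sum_(j < n.+1) a j * b (n - j)%N.
have dist n : nm (series a n * series b n - series c n) <= A * B * (1 / 2) ^+ n.
  pose pa : {poly R[i]} := \poly_(i < n) a i.
  pose pb : {poly R[i]} := \poly_(i < n) b i.
  have paE k : nm pa`_k <= A * (1 / 8) ^+ k.
    rewrite coef_poly; case: ifP => // _.
    by rewrite Normc.normc0 mulr_ge0 ?exprn_ge0 //; lra.
  have pbE k : nm pb`_k <= B * (1 / 8) ^+ k.
    rewrite coef_poly; case: ifP => // _.
    by rewrite Normc.normc0 mulr_ge0 ?exprn_ge0 //; lra.
  have cE : series c n = \sum_(k < n) (pa * pb)`_k.
    rewrite /series /= big_mkord; apply: eq_bigr => k _; rewrite coefM.
    apply: eq_bigr => j _; rewrite !coef_poly.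
    by rewrite !ifT ?(leq_ltn_trans (leq_subr _ _) (ltn_ord k)) //
      (leq_ltn_trans _ (ltn_ord k)) // -ltnS.
  have abE : series a n * series b n = \sum_(k < n + n) (pa * pb)`_k.
    transitivity ((pa * pb).[1]).
      rewrite hornerM !horner_poly /series /= !big_mkord.
      by congr (_ * _); apply: eq_bigr => k _; rewrite expr1n mulr1.
    rewrite (@horner_coef_wide _ (n + n)); last first.
      rewrite (leq_trans (size_polyMleq _ _)) // (leq_trans (leq_pred _)) //.
      by rewrite leq_add ?size_poly.
    by apply: eq_bigr => k _; rewrite expr1n mulr1.
  rewrite abE cE big_split_ord /= addrAC subrr add0r.
  apply: le_trans (normc_sum _ _) _.
  apply: (@le_trans _ _ (\sum_(k < n) A * B * (1 / 4) ^+ n)).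
    apply: ler_sum => k _; rewrite coefM; apply: le_trans (normc_sum _ _) _.
    apply: (@le_trans _ _ (\sum_(j < (n + k).+1) A * B * (1 / 8) ^+ (n + k))).
      apply: ler_sum => j _; rewrite Normc.normcM.
      have -> : A * B * (1 / 8) ^+ (n + k) =
          (A * (1 / 8) ^+ j) * (B * (1 / 8) ^+ (n + k - j)).
        rewrite -{1}(subnKC (_ : j <= n + k)%N) -1?ltnS // exprD; ring.
      by rewrite ler_pM ?normc_ge0.
    rewrite sumr_const card_ord -[_ *+ (n + k).+1]mulr_natl mulrCA ler_wpM2l ?mulr_ge0 //.
    apply: (@le_trans _ _ ((1 / 4) ^+ (n + k))); last first.
      by rewrite exprD ler_piMr ?exprn_ge0 ?exprn_ile1 //; lra.
    have -> : 1 / 4 = 2 * (1 / 8) :> R by field.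
    rewrite [leRHS]exprMn; apply: ler_wpM2r; first by rewrite exprn_ge0 ?divr_ge0.
    by rewrite -natrX ler_nat ltn_expl.
  rewrite sumr_const card_ord -[_ *+ n]mulr_natl mulrCA ler_wpM2l ?mulr_ge0 //.
  have -> : 1 / 2 = 2 * (1 / 4) :> R by field.
  rewrite [leRHS]exprMn; apply: ler_wpM2r; first by rewrite exprn_ge0 ?divr_ge0.
  by rewrite -natrX ler_nat ltnW // ltn_expl.
have pab : (fun n => series a n * series b n : R[i]^o) @ \oo --> (la * lb : R[i]^o).
  exact: (cvgM ala blb).
have c0 : (fun n => series a n * series b n - series c n : R[i]^o) @ \oo --> (0 : R[i]^o).
  apply/cvgc_normcP => e e0.
  have : geometric (A * B) (1 / 2 : R) @ \oo --> 0.
    by apply: cvg_geometric; rewrite ger0_norm; lra.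
  move=> /cvgrPdist_lt/(_ _ e0); apply: filterS => n.
  rewrite !sub0r normrN normcN ger0_norm; first exact: le_lt_trans.
  by rewrite /= !mulr_ge0 ?exprn_ge0 //; lra.
rewrite -[la * lb]subr0; suff -> : series c =
    (fun n => series a n * series b n) - (fun n => series a n * series b n - series c n).
  exact: (cvgB pab c0).
by apply/funext => n; rewrite fctE /= opprB addrC subrK.
Qed.

End ComplexLimits.

(** * Derivative of a series of polynomials *)

Section PolynomialSeries.
Context {R : realType}.
Local Notation nm := (@Normc.normc R).
Local Open Scope classical_set_scope.
Implicit Types (g : nat -> {poly R[i]}) (u s al be : R[i]) (rho kap A : R).

(* Moving [(u, s)] along the line [(u + al x, s + be x)] turns the two-variable
   monomial [p(u) s ^ n] into a polynomial in [x]. *)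
Definition line_poly (p : {poly R[i]}) n u s al be : {poly R[i]} :=
  (p \Po (al *: 'X + u%:P)) * (be *: 'X + s%:P) ^+ n.

Lemma horner_line p n u s al be x :
  (line_poly p n u s al be).[x] = p.[u + al * x] * (s + be * x) ^+ n.
Proof. by rewrite !hornerE horner_comp !hornerE addrC [be * x + s]addrC. Qed.

Lemma deriv_line p n u s al be : (line_poly p n u s al be)^`().[0] =
  al * (p^`().[u] * s ^+ n) + be * (n%:R * p.[u] * s ^+ n.-1).
Proof.
rewrite /line_poly derivM deriv_comp deriv_exp !derivD !derivZ !derivX !derivC !addr0.
rewrite hornerD !hornerM hornerMn hornerM !horner_exp !horner_comp.
rewrite !hornerD !hornerZ !hornerX !hornerC !mulr0 !add0r !mulr1 -[_ *+ n]mulr_natl.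
ring.
Qed.

Lemma pnorm_line p n u s al be kap rho : 0 <= rho -> nm al <= kap -> nm be <= 1 ->
  pnorm rho (line_poly p n u s al be) <=
  pnorm (nm u + kap * rho) p * (nm s + rho) ^+ n.
Proof.
move=> r0 ak b1.
have lin al' u' k : nm al' <= k -> pnorm rho (al' *: 'X + u'%:P) <= nm u' + k * rho.
  move=> ak'; rewrite -mul_polyC pnormMXaddC pnormC addrC lerD2l.
  by rewrite ler_wpM2r.
apply: le_trans (pnormM _ _ r0) _; apply: ler_pM; rewrite ?pnorm_ge0 //.
  by apply: le_trans (pnorm_comp _ _ r0) (le_pnorm _ _ (lin _ _ _ ak));
    rewrite pnorm_ge0.
apply: le_trans (pnormX _ _ r0) _; rewrite lerXn2r ?nnegrE ?pnorm_ge0 //.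
  by rewrite addr_ge0 ?normc_ge0.
by have := lin be s 1 b1; rewrite mul1r.
Qed.

(** A majorant bound over the polydisc of radii [kap * rho] about [u] and [rho] about [s]. It covers
    every complex line through [(u, s)] with [nm al <= kap] and [nm be <= 1]. *)
Definition line_bounded g u s kap rho A := forall n,
  pnorm (nm u + kap * rho) (g n) * (nm s + rho) ^+ n <= A * (1 / 8) ^+ n.

Lemma line_bounded_geo g u s kap rho A : 0 <= rho -> 0 <= kap ->
  line_bounded g u s kap rho A -> geo_bounded A (fun n => (g n).[u] * s ^+ n).
Proof.
move=> r0 k0 H n; apply: le_trans (H n); rewrite Normc.normcM normcX.
rewrite ler_pM ?exprn_ge0 ?normc_ge0 //.
  apply: le_trans (pnorm_horner _ _) (le_pnorm _ (normc_ge0 _) _).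
  by rewrite lerDl mulr_ge0.
by rewrite lerXn2r ?nnegrE ?addr_ge0 ?normc_ge0 // lerDl.
Qed.

(** Cauchy's estimate: the derivative at 0 is the coefficient of order 1, hence at most the norm of
    weight [rho] divided by [rho]. *)
Lemma line_bounded_deriv g u s kap rho A al be : 0 < rho ->
  nm al <= kap -> nm be <= 1 -> line_bounded g u s kap rho A ->
  geo_bounded (A / rho) (fun n => al * ((g n)^`().[u] * s ^+ n) +
    be * (n%:R * (g n).[u] * s ^+ n.-1)).
Proof.
move=> r0 ak b1 H n; rewrite -deriv_line horner_coef0 coef_deriv mulr1n.
rewrite mulrAC ler_pdivlMr //; apply: le_trans (H n).
apply: le_trans (pnorm_line _ _ _ _ (ltW r0) ak b1).
by have := pnorm_coef (line_poly (g n) n u s al be) 1 (ltW r0); rewrite expr1.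
Qed.

(** The line of direction [(v / h, 1)] reaches [(u + v, s + h)] at parameter [h], so the remainder
    in two variables is one in a single variable. *)
Lemma line_bounded_taylor g u s kap rho A v h : 0 < rho -> h != 0 ->
  nm h <= rho -> nm (v / h) <= kap -> line_bounded g u s kap rho A ->
  geo_bounded ((nm h / rho) ^+ 2 * A) (fun n =>
    (g n).[u + v] * (s + h) ^+ n - (g n).[u] * s ^+ n -
    (v * ((g n)^`().[u] * s ^+ n) + h * (n%:R * (g n).[u] * s ^+ n.-1))).
Proof.
move=> r0 h0 hr vk H n.
have n1 : nm 1 <= 1 by rewrite Normc.normc1.
have := pnorm_taylor (line_poly (g n) n u s (v / h) 1) r0 hr.
rewrite deriv_line !horner_line !mulr0 !addr0 [1 * h]mul1r [1 * (_ * _ * _)]mul1r.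
rewrite divfK // mulrDr [h * (_ / _ * _)]mulrA.
rewrite [h * (v / h)]mulrC divfK // => /le_trans; apply.
rewrite -[leRHS]mulrA ler_wpM2l ?sqr_ge0 //; apply: le_trans (H n).
exact: pnorm_line (ltW r0) vk n1.
Qed.

Definition poly_series g u s : R[i]^o :=
  limn (series (fun n => (g n).[u] * s ^+ n) : (R[i]^o) ^nat).

Lemma line_bounded_cvg g u s kap rho A : 0 <= rho -> 0 <= kap ->
  line_bounded g u s kap rho A ->
  (series (fun n => (g n).[u] * s ^+ n) : (R[i]^o) ^nat) @ \oo --> poly_series g u s.
Proof. by move=> r0 k0 H; apply: geo_bounded_cvg (line_bounded_geo r0 k0 H). Qed.

(** At the shifted point only convergence is needed, so zero radii suffice. *)
Lemma line_bounded_shift g u s kap rho A v h : 0 < rho -> 0 <= kap ->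
  nm h <= rho -> nm v <= kap * rho -> line_bounded g u s kap rho A ->
  line_bounded g (u + v) (s + h) 0 0 A.
Proof.
move=> r0 k0 hr vk H n; apply: le_trans (H n); rewrite mul0r !addr0.
rewrite ler_pM ?exprn_ge0 ?pnorm_ge0 ?normc_ge0 //.
  by rewrite le_pnorm ?normc_ge0 // (le_trans (le_normcD _ _)) // lerD2l.
rewrite lerXn2r ?nnegrE ?addr_ge0 ?normc_ge0 ?(ltW r0) //.
by rewrite (le_trans (le_normcD _ _)) // lerD2l.
Qed.

(** As [f] has derivative [s^-1], the chain rule turns each term into [s^-1] times a term of the
    same kind. The strict bound by [kap] keeps the slope [v / h] of the chord admissible for small
    [h]. *)
Lemma is_derive_poly_series g (f : R[i]^o -> R[i]^o) (t t0 : R[i]^o) kap rho A :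
  t != t0 -> 0 < rho -> nm (t - t0)^-1 < kap ->
  is_derive t (1 : R[i]^o) f (t - t0)^-1 ->
  line_bounded g (f t) (t - t0) kap rho A ->
  is_derive t (1 : R[i]^o) (fun t' => poly_series g (f t') (t' - t0))
    ((t - t0)^-1 * poly_series (fun n => (g n)^`() + n%:R *: g n) (f t) (t - t0)).
Proof.
move=> tt0 r0 ck fd H; set s := t - t0; set u := f t.
have s0 : s != 0 by rewrite subr_eq0.
have k0 : 0 < kap by apply: le_lt_trans ck; exact: normc_ge0.
have A0 : 0 <= A := geo_bounded_ge0 (line_bounded_geo (ltW r0) (ltW k0) H).
pose Su : R[i]^o := limn (series (fun n => (g n)^`().[u] * s ^+ n) : (R[i]^o) ^nat).
pose Ss : R[i]^o :=
  limn (series (fun n => n%:R * (g n).[u] * s ^+ n.-1) : (R[i]^o) ^nat).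
have cSu : (series (fun n => (g n)^`().[u] * s ^+ n) : (R[i]^o) ^nat) @ \oo --> Su.
  (* The slope [al = kap] is admissible whereas [al = 1] need not be; the factor [kap] is divided
     out again. *)
  have kk : nm kap%:C%C <= kap by rewrite normc_real ger0_norm ?(ltW k0).
  have n0 : nm 0 <= 1 by rewrite Normc.normc0.
  apply: (@geo_bounded_cvg _ (A / rho / kap)) => n.
  rewrite [A / rho / kap * _]mulrAC ler_pdivlMr // mulrC.
  have := line_bounded_deriv r0 kk n0 H n.
  by rewrite mul0r addr0 Normc.normcM normc_real ger0_norm ?(ltW k0).
have cSs : (series (fun n => n%:R * (g n).[u] * s ^+ n.-1) : (R[i]^o) ^nat) @ \oo --> Ss.
  have kk : nm 0 <= kap by rewrite Normc.normc0 ltW.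
  have n1 : nm 1 <= 1 by rewrite Normc.normc1.
  have := geo_bounded_cvg (line_bounded_deriv r0 kk n1 H).
  by under eq_fun do rewrite mul0r add0r mul1r.
have -> : s^-1 * poly_series (fun n => (g n)^`() + n%:R *: g n) u s = s^-1 * Su + Ss.
  suff -> : poly_series (fun n => (g n)^`() + n%:R *: g n) u s = Su + s * Ss.
    by rewrite mulrDr mulKf.
  apply: (cvg_lim (@norm_hausdorff _ (R[i]^o))).
  have -> : series (fun n => ((g n)^`() + n%:R *: g n).[u] * s ^+ n) =
      (fun n => series (fun n => (g n)^`().[u] * s ^+ n) n +
      s * series (fun n => n%:R * (g n).[u] * s ^+ n.-1) n).
    apply/funext => n; rewrite /series /= mulr_sumr -big_split /=.
    (* Index 0 is separate because [n.-1] is then 0 instead of -1; the factor [n%:R] vanishes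
       there. *)
    apply: eq_bigr => -[|k] _ /=; rewrite hornerD hornerZ ?exprS; first by ring.
    by rewrite mulrDl; congr (_ + _); ring.
  exact: (cvgD cSu (cvgMl_tmp (a := s) cSs)).
suff Q : (fun h : R[i]^o => h^-1 *: (poly_series g (f (h *: 1 + t)) (h *: 1 + t - t0) -
    poly_series g u s)) @ 0^' --> (s^-1 * Su + Ss : R[i]^o).
  by split; [apply/cvg_ex; exists (s^-1 * Su + Ss : R[i]^o)
            |apply: (cvg_lim (@norm_hausdorff _ (R[i]^o)))].
have fQ : (fun h : R[i]^o => h^-1 *: (f (h *: 1 + t) - f t)) @ 0^' --> (s^-1 : R[i]^o).
  by case: fd => fe fv; rewrite -fv; exact: fe.
have lQ : (fun h : R[i]^o => (h^-1 *: (f (h *: 1 + t) - f t)) * Su + Ss : R[i]^o) @ 0^' -->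
    (s^-1 * Su + Ss : R[i]^o).
  by apply: cvgD; [apply: cvgMr_tmp|exact: cvg_cst].
(* The comparison uses the difference quotient of [f] itself, not its limit, so the error is linear
   in [h] whatever the rate at which that quotient converges. *)
have key h : h != 0 -> nm h <= rho -> nm (h^-1 * (f (h + t) - f t)) <= kap ->
  nm (h^-1 * (poly_series g (f (h + t)) (h + t - t0) - poly_series g u s) -
    (h^-1 * (f (h + t) - f t) * Su + Ss)) <= 2 * A / rho ^+ 2 * nm h.
  move=> h0 hr vk; set v := f (h + t) - f t.
  have vE : v / h = h^-1 * v by rewrite mulrC.
  have vkr : nm v <= kap * rho.
    rewrite -[v](divfK h0) Normc.normcM ler_pM ?normc_ge0 //; first by rewrite vE.
  have Hh := line_bounded_shift r0 (ltW k0) hr vkr H.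
  have fE : f (h + t) = u + v by rewrite /v /u addrCA subrr addr0.
  have sE : h + t - t0 = s + h by rewrite /s; ring.
  have T := line_bounded_taylor r0 h0 hr (_ : nm (v / h) <= kap) H.
  rewrite vE in T; move: {T}(T vk) => T.
  have c1 := line_bounded_cvg (lexx 0) (lexx 0) Hh.
  have c2 := line_bounded_cvg (ltW r0) (ltW k0) H.
  have cT : (series (fun n => (g n).[u + v] * (s + h) ^+ n - (g n).[u] * s ^+ n -
      (v * ((g n)^`().[u] * s ^+ n) + h * (n%:R * (g n).[u] * s ^+ n.-1)))
      : (R[i]^o) ^nat) @ \oo -->
      (poly_series g (u + v) (s + h) - poly_series g u s - (v * Su + h * Ss) : R[i]^o).
    set S := series _.
    have -> : S = (fun n => series (fun n => (g n).[u + v] * (s + h) ^+ n) n -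
      series (fun n => (g n).[u] * s ^+ n) n -
      (v * series (fun n => (g n)^`().[u] * s ^+ n) n +
       h * series (fun n => n%:R * (g n).[u] * s ^+ n.-1) n)).
      apply/funext => n; rewrite /S /series /= !mulr_sumr -!sumrB -big_split /=.
      by rewrite -sumrB.
    exact: (cvgB (cvgB c1 c2) (cvgD (cvgMl_tmp (a := v) cSu) (cvgMl_tmp (a := h) cSs))).
  have := geo_bounded_lim T cT; rewrite fE sE.
  set G1 := poly_series _ _ _; set G0 := poly_series _ _ _.
  have -> : h^-1 * (G1 - G0) - (h^-1 * v * Su + Ss) =
    h^-1 * (G1 - G0 - (v * Su + h * Ss)) by field.
  rewrite Normc.normcM Normc.normcV => B.
  have hp : 0 < nm h by rewrite normc_gt0.
  rewrite mulrC ler_pdivrMr //; apply: le_trans B _.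
  rewrite le_eqVlt; apply/orP; left; apply/eqP; field.
  by rewrite gt_eqF.
apply/cvgc_normcP => e e0.
have e2 : 0 < e / 2 by rewrite divr_gt0.
have nk : \forall h \near (0 : R[i]^o)^', nm (h^-1 * (f (h + t) - f t)) <= kap.
  have d0 : 0 < kap - nm s^-1 by rewrite subr_gt0.
  move/cvgc_normcP: fQ => /(_ _ d0); apply: filterS => h.
  rewrite normcB /GRing.scale /= mulr1 => hd.
  rewrite -[X in nm X](subrK s^-1) (le_trans (le_normcD _ _)) //.
  by rewrite -lerBrDr ltW.
have nr c : 0 < c -> \forall h \near (0 : R[i]^o)^', nm h < c.
  move=> c0; apply: nbhs_dnbhs; have := @cvg_id _ (nbhs (0 : R[i]^o)).
  by move/cvgc_normcP => /(_ _ c0); apply: filterS => h; rewrite sub0r normcN.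
move/cvgc_normcP: lQ => /(_ _ e2) lQ.
(* The summand 1 keeps the divisor positive when [A = 0]. *)
have C0 : 0 < 2 * A / rho ^+ 2 + 1 by rewrite ltr_wpDl ?divr_ge0 ?mulr_ge0 ?exprn_ge0 ?(ltW r0).
near=> h.
have h0 : h != 0 by near: h; exact: nbhs_dnbhs_neq.
have hr : nm h <= rho by rewrite ltW //; near: h; exact: nr.
have vk : nm (h^-1 * (f (h + t) - f t)) <= kap by near: h; exact: nk.
have hs : nm h < e / 2 / (2 * A / rho ^+ 2 + 1) by near: h; apply: nr; exact: divr_gt0.
have := key h h0 hr vk.
have : nm (s^-1 * Su + Ss - (h^-1 * (f (h * 1 + t) - f t) * Su + Ss)) < e / 2.
  by near: h; exact: lQ.
rewrite /GRing.scale /= !mulr1 => H1 H2.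
rewrite normcB -[X in nm X](subrKA (h^-1 * (f (h + t) - f t) * Su + Ss)).
apply: le_lt_trans (le_normcD _ _) _; rewrite [e]splitr ler_ltD //; last by rewrite normcB.
apply: le_trans H2 _; move: hs; rewrite ltr_pdivlMr // mulrDr mulr1 => hs.
by rewrite mulrC (le_trans _ (ltW hs)) // lerDl normc_ge0.
Unshelve. all: by end_near. Qed.

End PolynomialSeries.

(** * The principal logarithm *)

Section ComplexLogarithm.
Context {R : realType}.
Local Notation nm := (@Normc.normc R).
Implicit Types z w : R[i].
Local Notation Re := (@complex.Re R).
Local Notation Im := (@complex.Im R).
Local Open Scope classical_set_scope.

(** The exponential serves to invert [clog]: additivity and the behaviour at 0 are enough to
    differentiate [clog] at every point off the cut. *)
Definition cexp (w : R[i]) : R[i] :=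
  Complex (expR (Re w) * cos (Im w)) (expR (Re w) * sin (Im w)).

Lemma cexpD w1 w2 : cexp (w1 + w2) = cexp w1 * cexp w2.
Proof.
case: w1 w2 => a1 b1 [a2 b2]; rewrite /cexp /= expRD cosD sinD.
by apply/eqP; rewrite eq_complex /=; apply/andP; split; apply/eqP; ring.
Qed.

Lemma Re_div_normc_itv z : -1 <= Re z / nm z <= 1.
Proof.
have [->|z0] := eqVneq z 0; first by rewrite Normc.normc0 invr0 mulr0; lra.
have n0 : 0 < nm z by rewrite normc_gt0.
rewrite -ler_norml normrM normfV (gtr0_norm n0) ler_pdivrMr // mul1r.
exact: ge_normc_Re.
Qed.

Lemma normc_carg z : `|carg z| <= pi.
Proof.
have a0 := acos_ge0 (Re_div_normc_itv z); have a1 := acos_lepi (Re_div_normc_itv z).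
by rewrite /carg; case: ifP => _; rewrite ?normrN ger0_norm.
Qed.

Lemma normc_clog z : nm (clog z) <= `|ln (nm z)| + pi.
Proof. by apply: le_trans (le_normc_ReIm _) _; rewrite lerD2l normc_carg. Qed.

Lemma normc_sqr z : nm z ^+ 2 = Re z ^+ 2 + Im z ^+ 2.
Proof. by case: z => x y /=; rewrite sqr_sqrtr // addr_ge0 ?sqr_ge0. Qed.

Lemma cexp_clog z : z != 0 -> cexp (clog z) = z.
Proof.
move=> z0; have n0 : 0 < nm z by rewrite normc_gt0.
have I := Re_div_normc_itv z.
(* The sine belonging to [acos] is nonnegative; the test in [carg] restores the sign of [Im z]. *)
have sn : nm z * Num.sqrt (1 - (Re z / nm z) ^+ 2) = `|Im z|.
  rewrite -[X in X * _](gtr0_norm n0) -sqrtr_sqr -sqrtrM ?sqr_ge0 // -sqrtr_sqr.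
  congr Num.sqrt; rewrite mulrBr mulr1 expr_div_n mulrCA divff ?mulr1.
    by rewrite normc_sqr addrC addKr.
  by rewrite expf_neq0 // gt_eqF.
rewrite /cexp /clog /= lnK // /carg.
have Re_ : nm z * cos (acos (Re z / nm z)) = Re z.
  by rewrite acosK ?in_itv //= mulrCA divff ?mulr1 // gt_eqF.
case: ifPn => [y0|]; last rewrite -ltNge => y0.
  rewrite Re_ sin_acos // sn ger0_norm //; by case: (z).
rewrite cosN sinN Re_ sin_acos // mulrN sn ltr0_norm // opprK; by case: (z).
Qed.

(* The half-angle formula is uniform in the slit plane [0 < nm z + Re z], whereas [acos]
   is not differentiable on the positive axis. *)
Lemma carg_atan z : 0 < nm z + Re z -> carg z = 2 * atan (Im z / (nm z + Re z)).
Proof.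
move=> d0; set d := nm z + Re z; set T := Im z / d; set phi := atan T.
have [z0|z0] := eqVneq z 0; first by move: d0; rewrite z0 Normc.normc0 /= addr0 ltxx.
have n0 : 0 < nm z by rewrite normc_gt0.
have d1 : d != 0 by rewrite gt_eqF.
have T2 : 0 < 1 + T ^+ 2 by rewrite ltr_pwDl ?sqr_ge0.
have c2 : cos (2 * phi) = Re z / nm z.
  have -> : 2 * phi = phi *+ 2 by rewrite mulr_natl.
  rewrite cos_mulr2n cos_atan exprVn sqr_sqrtr ?(ltW T2) //.
  have y2 : Im z ^+ 2 = nm z ^+ 2 - Re z ^+ 2 by rewrite normc_sqr addrC addKr.
  (* Since [Im z ^+ 2 = (nm z - Re z) * d], one has [T ^+ 2 = (nm z - Re z) / d]. *)
  have -> : 1 + T ^+ 2 = 2 * nm z / d.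
    rewrite /T expr_div_n y2; apply: (mulIf (expf_neq0 2 d1)).
    rewrite mulrDl divfK ?expf_neq0 // mul1r expr2 mulrA divfK // /d; ring.
  rewrite invf_div -mulr_natl; apply/eqP; rewrite -subr_eq0; apply/eqP.
  by rewrite /d; field; rewrite gt_eqF.
have [p1 p2] : phi < pi / 2 /\ - (pi / 2) < phi by rewrite atan_ltpi2 atan_gtNpi2.
rewrite /carg -c2; case: ifPn => [y0|]; last rewrite -ltNge => y0.
  have : 0 <= phi by rewrite -atan0 le_atan // divr_ge0 // ltW.
  by move=> f0; rewrite cosK // in_itv /=; apply/andP; split; lra.
have : phi <= 0 by rewrite -atan0 le_atan // pmulr_lle0 ?invr_gt0 // ltW.
by move=> f0; rewrite cosKN ?opprK //; apply/andP; split; lra.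
Qed.

Lemma lipschitz1_cvg (phi : R[i]^o -> R) (z : R[i]^o) :
  (forall z1 z2, `|phi z1 - phi z2| <= nm (z1 - z2)) -> phi @ z --> phi z.
Proof.
move=> L; apply/(@cvgrPdist_lt _ _ _ (nbhs z)) => e e0; have := @cvg_id _ (nbhs (z : R[i]^o)).
by move/cvgc_normcP => /(_ _ e0); apply: filterS => h; exact: le_lt_trans.
Qed.

Lemma clog_cvg (z : R[i]^o) : 0 < nm z + Re z ->
  (clog : R[i]^o -> R[i]^o) @ z --> (clog z : R[i]^o).
Proof.
move=> d0.
have cRe : (Re : R[i]^o -> R) @ z --> Re z.
  apply: lipschitz1_cvg => z1 z2; rewrite -raddfB; exact: ge_normc_Re.
have cIm : (Im : R[i]^o -> R) @ z --> Im z.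
  apply: lipschitz1_cvg => z1 z2; rewrite -raddfB; exact: ge_normc_Im.
have cnm : (nm : R[i]^o -> R) @ z --> nm z.
  apply: lipschitz1_cvg => z1 z2.
  have := le_normcD (z1 - z2) z2; have := le_normcD (z2 - z1) z1.
  by rewrite !subrK (normcB z2) ler_norml => ? ?; apply/andP; split; lra.
have z0 : 0 < nm z.
  by rewrite normc_gt0; apply: contraTneq d0 => ->; rewrite Normc.normc0 addr0 ltxx.
have cln : ln (nm x) @[x --> z] --> ln (nm z).
  by apply: (cvg_comp _ _ cnm); exact: continuous_ln.
have cden : (nm x + Re x) @[x --> z] --> nm z + Re z by exact: (cvgD cnm cRe).
have ccarg : carg x @[x --> z] --> carg z.
  have ca : 2 * atan (Im x / (nm x + Re x)) @[x --> z] --> carg z.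
    rewrite carg_atan //.
    have cq : Im x / (nm x + Re x) @[x --> z] --> Im z / (nm z + Re z).
      by apply: (cvgM cIm); apply: cvgV => //; rewrite gt_eqF.
    have cat : atan (Im x / (nm x + Re x)) @[x --> z] --> atan (Im z / (nm z + Re z)).
      by apply: (cvg_comp _ _ cq); exact: continuous_atan.
    exact: (cvgMl_tmp (a := 2) cat).
  have near_pos : \forall x \near z, 0 < nm x + Re x by exact: (cvgr_gt _ cden).
  have near_eq : {near z, (fun x : R[i]^o => 2 * atan (Im x / (nm x + Re x))) =1 carg}.
    by apply: filterS near_pos => x /carg_atan ->.
  exact: (cvg_trans (near_eq_cvg near_eq) ca).
apply/(@cvgc_normcP _ _ (nbhs z)) => e e0; have e2 : 0 < e / 2 by rewrite divr_gt0.
move/cvgrPdist_lt/(_ _ e2): cln => cln; move/cvgrPdist_lt/(_ _ e2): ccarg => ccarg.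
near=> x; apply: le_lt_trans (le_normc_ReIm _) _; rewrite [e]splitr !raddfB /=.
by rewrite ltrD //; near: x; [exact: cln|exact: ccarg].
Unshelve. all: by end_near. Qed.

Lemma is_derive0_littleo (f : R -> R) (d : R) : is_derive (0 : R) (1 : R) f d ->
  forall e, 0 < e -> \forall x \near (0 : R), `|f x - f 0 - d * x| <= e * `|x|.
Proof.
move=> [df <-] e e0; have /cvgrPdist_le/(_ _ e0) := df.
rewrite -[lim _]/('D_1 f 0) => H.
have H2 : \forall x \near (0 : R), x != 0 ->
    `|'D_1 f 0 - x^-1 *: (f (x *: 1 + 0) - f 0)| <= e by exact: H.
near=> x; have [->|x0] := eqVneq x 0.
  by rewrite subrr mulr0 subr0 normr0 mulr0.
have : `|'D_1 f 0 - x^-1 *: (f (x *: 1 + 0) - f 0)| <= e.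
  by move: x0; near: x.
rewrite addr0 [x *: 1]mulr1 [_ *: _]mulrC => Hx.
have -> : f x - f 0 - 'D_1 f 0 * x = - ('D_1 f 0 - (f x - f 0) / x) * x.
  by field.
by rewrite normrM normrN ler_wpM2r.
Unshelve. all: by end_near. Qed.

Lemma cexp_littleo (e : R) : 0 < e ->
  exists2 d : R, 0 < d & forall w, nm w < d -> nm (cexp w - 1 - w) <= e * nm w.
Proof.
(* The four error terms contribute [1 + 2 + 2 + 1] times [e' * nm w], where 2 bounds [expR a]. *)
move=> e0; pose e' := e / 6; have e'0 : 0 < e' by rewrite divr_gt0.
have Hexp := is_derive0_littleo (is_derive_expR (0 : R)) e'0.
have Hcos := is_derive0_littleo (is_derive_cos (0 : R)) e'0.
have Hsin := is_derive0_littleo (is_derive_sin (0 : R)) e'0.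
have Hc1 : \forall x \near (0 : R), `|expR x - 1| < Num.min 1 e'.
  have := @continuous_expR R 0; rewrite /continuous_at expR0 => /cvgrPdist_lt.
  have m0 : 0 < Num.min 1 e' by rewrite lt_min ltr01.
  by move=> /(_ _ m0); apply: filterS => x; rewrite distrC.
have [d /= d0 H] :=
  (nbhs_ballP (0 : R) _).1 (filterI (filterI Hexp Hcos) (filterI Hsin Hc1)).
exists d => // w wd; set a := Re w; set b := Im w.
have ad : `|a| < d by apply: le_lt_trans wd; exact: ge_normc_Re.
have bd : `|b| < d by apply: le_lt_trans wd; exact: ge_normc_Im.
have Bd x : `|x| < d -> ball (0 : R) d x by move=> xd; rewrite /ball /= sub0r normrN.
have [[/= ea _] [_ /=]] := H a (Bd a ad).
rewrite lt_min => /andP[ea1 ea2].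
have [[_ /= cb] [/= sb _]] := H b (Bd b bd).
move: ea cb sb; rewrite expR0 cos0 sin0 oppr0 mul0r !subr0 !mul1r ?addr0 => ea cb sb.
apply: le_trans (le_normc_ReIm _) _.
have -> : Re (cexp w - 1 - w) = expR a * cos b - 1 - a by rewrite !raddfB.
have -> : Im (cexp w - 1 - w) = expR a * sin b - b by rewrite !raddfB /= subr0.
have Ea : `|expR a| <= 2.
  have := ler_normD (expR a - 1) 1; rewrite subrK normr1 => h.
  by apply: le_trans h _; lra.
have -> : expR a * cos b - 1 - a = (expR a - 1 - a) + expR a * (cos b - 1) by ring.
have -> : expR a * sin b - b = expR a * (sin b - b) + (expR a - 1) * b by ring.
have ta : `|a| <= nm w := ge_normc_Re w.
have tb : `|b| <= nm w := ge_normc_Im w.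
set N := nm _ in ta tb *.
have e'N x : x <= N -> e' * x <= e' * N by rewrite ler_pM2l.
have P1 : `|expR a * (cos b - 1)| <= 2 * (e' * N).
  by rewrite normrM ler_pM // (le_trans cb) // e'N.
have P2 : `|expR a * (sin b - b)| <= 2 * (e' * N).
  by rewrite normrM ler_pM // (le_trans sb) // e'N.
have P3 : `|(expR a - 1) * b| <= e' * N by rewrite normrM ler_pM // ltW.
have P0 : `|expR a - 1 - a| <= e' * N by apply: le_trans ea _; exact: e'N.
have := ler_normD (expR a - 1 - a) (expR a * (cos b - 1)).
have := ler_normD (expR a * (sin b - b)) ((expR a - 1) * b).
have -> : e * N = 6 * (e' * N) by rewrite /e'; field.
by move=> ? ?; lra.
Qed.

(* Writing [w] for the increment of the logarithm, [h / z = cexp w - 1 = w + o(w)], so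
   that [w / h --> 1 / z]. *)
Lemma is_derive_clog (C b : R[i]) (t t0 : R[i]^o) :
  0 < nm (b * (t - t0)) + Re (b * (t - t0)) ->
  is_derive t (1 : R[i]^o) (fun t' : R[i]^o => clog (b * (t' - t0)) + C : R[i]^o)
    (t - t0)^-1.
Proof.
set s := t - t0; set z := b * s => d0.
have z0 : z != 0 by apply: contraTneq d0 => ->; rewrite Normc.normc0 addr0 ltxx.
have /andP[b0 s0] : (b != 0) && (s != 0) by rewrite -negb_or -mulf_eq0.
pose w (h : R[i]^o) : R[i]^o := clog (b * (h + s)) - clog z.
have w0 : w @ (0 : R[i]^o) --> (0 : R[i]^o).
  have c1 : (fun h : R[i]^o => b * (h + s) : R[i]^o) @ (0 : R[i]^o) --> (z : R[i]^o).
    have c0 : (h + s) @[h --> (0 : R[i]^o)] --> (0 + s : R[i]^o).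
      exact: (cvgD (@cvg_id _ _) (cvg_cst _)).
    by rewrite add0r in c0; exact: (cvgMl_tmp (a := b) c0).
  have c2 : (fun h : R[i]^o => clog (b * (h + s)) : R[i]^o) @ (0 : R[i]^o) -->
      (clog z : R[i]^o).
    by apply: (cvg_comp _ _ c1); exact: clog_cvg.
  have c3 : w h @[h --> (0 : R[i]^o)] --> (clog z - clog z : R[i]^o).
    exact: (cvgB c2 (cvg_cst (clog z : R[i]^o))).
  by rewrite subrr in c3.
(* Working through [cexp] avoids an addition formula for [clog], which would hold only up to
   multiples of [2 pi i]. *)
have cw h : h + s != 0 -> cexp (w h) - 1 = h / s.
  move=> hs0; have : cexp (w h) * z = b * (h + s).
    rewrite -{1}(cexp_clog z0) -cexpD subrK cexp_clog ?mulf_neq0 //.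
  by move=> /(canRL (mulfK z0)) ->; rewrite /z; field; rewrite b0 s0.
suff Q : (fun h : R[i]^o => h^-1 *: (clog (b * (h *: 1 + t - t0)) + C -
    (clog (b * (t - t0)) + C)) : R[i]^o) @ (0 : R[i]^o)^' --> (s^-1 : R[i]^o).
  by split; [apply/cvg_ex; exists (s^-1 : R[i]^o)
            |apply: (cvg_lim (@norm_hausdorff _ (R[i]^o)))].
apply/(@cvgc_normcP _ _ (0 : R[i]^o)^') => e e0.
have n0 : 0 < nm s by rewrite normc_gt0.
(* The bound 1/2 gives [nm (w h) <= 2 * nm (h / s)] by absorption; the other bound then makes the
   error at most [e * nm h / 2]. *)
pose e' := Num.min (1 / 2) (e * nm s / 4).
have e'0 : 0 < e' by rewrite lt_min !divr_gt0 ?mulr_gt0.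
have [d dd0 Hd] := cexp_littleo e'0.
have nw : \forall h \near (0 : R[i]^o)^', nm (w h) < d.
  apply: nbhs_dnbhs; move/(@cvgc_normcP _ _ (nbhs (0 : R[i]^o))): w0 => /(_ _ dd0).
  by apply: filterS => h; rewrite sub0r normcN.
have nh : \forall h \near (0 : R[i]^o)^', nm h < nm s.
  apply: nbhs_dnbhs; have := @cvg_id _ (nbhs (0 : R[i]^o)).
  by move/cvgc_normcP => /(_ _ n0); apply: filterS => h; rewrite sub0r normcN.
near=> h.
have h0 : h != 0 by near: h; exact: nbhs_dnbhs_neq.
have hs : nm h < nm s by near: h; exact: nh.
have wd : nm (w h) < d by near: h; exact: nw.
have hs0 : h + s != 0.
  by apply: contraTneq hs => /eqP; rewrite addr_eq0 => /eqP ->; rewrite normcN ltxx.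
have hp : 0 < nm h by rewrite normc_gt0.
have := Hd _ wd; rewrite (cw _ hs0) => H.
have -> : h *: 1 + t - t0 = h + s by rewrite /GRing.scale /= mulr1 addrA.
rewrite opprD addrACA subrr addr0 -/z -/(w h) /GRing.scale /=.
have -> : s^-1 - h^-1 * w h = h^-1 * (h / s - w h) by field; rewrite h0 s0.
rewrite Normc.normcM Normc.normcV mulrC ltr_pdivrMr //.
apply: le_lt_trans H _.
have [e'1 e'2] : e' <= 1 / 2 /\ e' <= e * nm s / 4 by rewrite !ge_min !lexx orbT.
have : nm (w h) <= nm (h / s) + nm (h / s - w h).
  by have := le_normcB (h / s) (h / s - w h); rewrite opprB addrC subrK.
have := Hd _ wd; rewrite (cw _ hs0) Normc.normcM Normc.normcV.
set W := nm (w h); set q := nm h / nm s => H1 H2.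
have W0 : 0 <= W := normc_ge0 _.
have q0 : 0 < q by rewrite divr_gt0.
have hq : nm h = q * nm s by rewrite /q divfK // gt_eqF.
have W2 : W <= 2 * q.
  have : e' * W <= 1 / 2 * W by rewrite ler_wpM2r.
  by lra.
apply: (@le_lt_trans _ _ (e * nm s / 4 * (2 * q))); first by rewrite ler_pM // ltW.
have -> : e * nm s / 4 * (2 * q) = e * nm h / 2 by rewrite hq; field.
by rewrite ltr_pdivrMr // ltr_pMr ?mulr_gt0 //; lra.
Unshelve. all: by end_near. Qed.

End ComplexLogarithm.

(** * Growth of the formal solutions *)

Section Growth.
Context {R : realType}.
Implicit Types (x : nat -> R).

(** The induction proves [x n <= M * K ^+ n.-1]: a product [x j * x (n - j)] then carries only
    [K ^+ (n - 2)], and the spare factor [K] absorbs [2 * c1 + c2 * M]. The constant [M] bounds the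
    first [N] values. *)
Lemma quadratic_recursion_growth x c1 c2 N : (2 < N)%N -> 0 <= c1 -> 0 <= c2 ->
  (forall n, 0 <= x n) ->
  (forall n, (N <= n)%N -> n%:R * x n <=
     c1 * (x n.-1 + x n.-2) + c2 * \sum_(1 <= j < n) x j * x (n - j)%N) ->
  exists2 MK : R * R, 0 <= MK.1 /\ 1 <= MK.2 & forall n, x n <= MK.1 * MK.2 ^+ n.
Proof.
move=> N2 c10 c20 x0 rec; pose M := \sum_(j < N) x j; pose K := 2 * c1 + c2 * M + 1.
have M0 : 0 <= M by apply: sumr_ge0.
have K1 : 1 <= K by rewrite lerDr addr_ge0 ?mulr_ge0.
have K0 : 0 <= K by apply: le_trans K1.
suff main n : x n <= M * K ^+ n.-1.
  exists (M, K) => // n; apply: le_trans (main n) _.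
  by rewrite ler_wpM2l // ler_weXn2l // leq_pred.
have [k] := ubnP n; elim: k n => // k IH n; rewrite ltnS => nk.
have [nN|Nn] := ltnP n N.
  apply: (@le_trans _ _ M).
    by rewrite /M (bigD1 (Ordinal nN)) //= lerDl sumr_ge0.
  by rewrite ler_peMr // exprn_ege1.
have n0 : (0 : R) < n%:R by rewrite ltr0n; lia.
rewrite -(ler_pM2l n0); apply: le_trans (rec n Nn) _.
have b1 j : (0 < j < n)%N -> x j <= M * K ^+ j.-1 by move=> ?; apply: IH; lia.
have -> : n%:R * (M * K ^+ n.-1) = n%:R * M * K ^+ n.-2 * K.
  by rewrite -[RHS]mulrA -exprSr -[RHS]mulrA; congr (_ * (_ * _ ^+ _)); lia.
have h1 : x n.-1 <= M * K ^+ n.-2 by apply: b1; lia.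
have h2 : x n.-2 <= M * K ^+ n.-2.
  by apply: le_trans (b1 _ _) _; rewrite ?ler_wpM2l ?ler_weXn2l //; lia.
have h3 : \sum_(1 <= j < n) x j * x (n - j)%N <= n%:R * (M * M * K ^+ n.-2).
  apply: (@le_trans _ _ (\sum_(1 <= j < n) M * M * K ^+ n.-2)).
    rewrite !big_nat; apply: ler_sum => j /andP[j1 jn].
    have -> : M * M * K ^+ n.-2 = (M * K ^+ j.-1) * (M * K ^+ (n - j).-1).
      by rewrite mulrACA -exprD; congr (_ * _ ^+ _); lia.
    by rewrite ler_pM // b1 //; lia.
  rewrite big_const_nat iter_addr_0 -[_ *+ _]mulr_natl ler_wpM2r ?mulr_ge0 ?exprn_ge0 //.
  by rewrite ler_nat leq_subr.
set P := K ^+ n.-2 in h1 h2 h3 *.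
have P0 : 0 <= P by rewrite exprn_ge0.
have n1 : (1 : R) <= n%:R by rewrite ler1n; lia.
have h4 : c1 * (x n.-1 + x n.-2) <= n%:R * (M * P * (2 * c1)).
  apply: (@le_trans _ _ (M * P * (2 * c1))); last first.
    by rewrite ler_peMl // !mulr_ge0.
  have -> : M * P * (2 * c1) = c1 * (M * P + M * P) by ring.
  by rewrite ler_wpM2l // lerD.
have h5 : c2 * \sum_(1 <= j < n) x j * x (n - j)%N <= c2 * (n%:R * (M * M * P)).
  by rewrite ler_wpM2l.
apply: le_trans (lerD h4 h5) _; rewrite /K -subr_ge0.
set d := (X in 0 <= X); have -> : d = n%:R * (M * P) by rewrite /d; ring.
by rewrite !mulr_ge0 // ltW.
Qed.

End Growth.

(** * Majorants of formal solutions of the Lorenz system *)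

Section FormalSolutions.
Context {R : realType}.
Local Notation nm := (@Normc.normc R).
Implicit Types (p q r : nat -> {poly R[i]}).

(** The coefficients of [s ^+ k] times the series of [g]; the test keeps truncated subtraction from
    producing copies of [g 0]. *)
Definition delay (V : zmodType) k (g : nat -> V) n : V :=
  if (n < k)%N then 0 else g (n - k)%N.

(* With [p n = P_(n - 1)], [q n = Q_(n - 2)] and [r n = R_(n - 2)] these are the
   coefficients of the Lorenz equations at a fixed power of [t - t0]. *)
Definition formal_lorenz p q r := forall n : nat,
  [/\ (p n)^`() + (n%:R - 1) *: p n = 10 *: (q n - delay 1 p n),
      (q n)^`() + (n%:R - 2) *: q n = 28 *: delay 2 p n - delay 1 q n
         - \sum_(j < n.+1) p j * r (n - j)%N
    & (r n)^`() + (n%:R - 2) *: r n = - (8 / 3) *: delay 1 r n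
         + \sum_(j < n.+1) p j * q (n - j)%N].

(** With [n = m + 2] this is the degree bound [floor ((m + 2) / 2)], at which the sum defining [X_m]
    stops. *)
Definition half_size (g : nat -> {poly R[i]}) := forall n, (size (g n) <= n./2.+1)%N.

Lemma pnorm_ode (g f : {poly R[i]}) n (c : R[i]) : (size g <= n./2.+1)%N ->
  g^`() + (n%:R - c) *: g = f ->
  n%:R * pnorm 4 g <= pnorm 4 f + nm c * pnorm 4 g + n%:R / 8 * pnorm 4 g.
Proof.
move=> gs gf; have w0 : 0 <= 4 :> R by [].
have -> : n%:R * pnorm 4 g = pnorm 4 (f + c *: g - g^`()).
  by rewrite -gf scalerBl addrC addrA addrCA -[n%:R in LHS]normc_natr -pnormZ; congr pnorm; ring.
apply: le_trans (pnormD _ _ w0) _; rewrite pnormN; apply: lerD.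
  by apply: le_trans (pnormD _ _ w0) _; rewrite pnormZ.
apply: le_trans (pnorm_deriv _ gs) _ => //; rewrite ler_wpM2r ?pnorm_ge0 //.
rewrite ler_pdivrMr // mulrAC ler_pdivlMr // -!natrM ler_nat.
lia.
Qed.

Lemma pnorm_delay k (g : nat -> {poly R[i]}) n :
  pnorm 4 (delay k g n) <= pnorm 4 (g (n - k)%N).
Proof. by rewrite /delay; case: ifP; rewrite ?pnorm0 ?pnorm_ge0. Qed.

(** After the derivative terms, [7 / 8 * N] times the total remains on the left; the linear terms
    cost at most [12 + 2 * X], hence at most [3 / 8 * N]. Doubling the bound for the remaining
    [N / 2] gives [56 = 2 * 28] and [4 = 2 * 2]. *)
Lemma growth_step (N a b c X y z S : R) :
  0 <= a -> 0 <= b -> 0 <= c -> 0 <= X -> 0 <= y -> 0 <= z -> 0 <= S ->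
  20 + 2 * X <= 3 / 8 * N ->
  N * a <= 10 * (b + y) + 1 * a + N / 8 * a ->
  N * b <= (28 * z + y + (X * c + X * a + S)) + 2 * b + N / 8 * b ->
  N * c <= (8 / 3 * y + (X * b + X * a + S)) + 2 * c + N / 8 * c ->
  N * (a + b + c) <= 56 * (y + z) + 4 * S.
Proof.
move=> a0 b0 c0 X0 y0 z0 S0 XN ha hb hc.
have : (20 + 2 * X) * (a + b + c) <= 3 / 8 * N * (a + b + c).
  by rewrite ler_wpM2r ?addr_ge0.
have := mulr_ge0 X0 a0; have := mulr_ge0 X0 b0; have := mulr_ge0 X0 c0.
lra.
Qed.

Lemma formal_lorenz_growth p q r : formal_lorenz p q r ->
  half_size p -> half_size q -> half_size r ->
  exists2 MK : R * R, 0 <= MK.1 /\ 1 <= MK.2 & forall n,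
    [/\ pnorm 4 (p n) <= MK.1 * MK.2 ^+ n, pnorm 4 (q n) <= MK.1 * MK.2 ^+ n
      & pnorm 4 (r n) <= MK.1 * MK.2 ^+ n].
Proof.
move=> ode sp sq sr; have w0 : 0 <= 4 :> R by [].
pose x n := pnorm 4 (p n) + pnorm 4 (q n) + pnorm 4 (r n).
have [p0 q0 r0] : [/\ forall n, 0 <= pnorm 4 (p n), forall n, 0 <= pnorm 4 (q n)
    & forall n, 0 <= pnorm 4 (r n)] by split=> n; exact: pnorm_ge0.
have px n : pnorm 4 (p n) <= x n by rewrite /x; have := q0 n; have := r0 n; lra.
have qx n : pnorm 4 (q n) <= x n by rewrite /x; have := p0 n; have := r0 n; lra.
have rx n : pnorm 4 (r n) <= x n by rewrite /x; have := p0 n; have := q0 n; lra.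
have x0 n : 0 <= x n by apply: le_trans (px n).
suff [N N2 rec] : exists2 N, (2 < N)%N & forall n, (N <= n)%N -> n%:R * x n <=
     56 * (x n.-1 + x n.-2) + 4 * \sum_(1 <= j < n) x j * x (n - j)%N.
  have [MK MK0 H] := quadratic_recursion_growth N2 (ler0n _ 56) (ler0n _ 4) x0 rec.
  by exists MK => // n; split; apply: le_trans (H n).
pose E := 20 + 2 * x 0%N.
have [N NE] : exists N : nat, 3 / 8 * N%:R >= E.
  exists (Num.truncn (8 / 3 * E)).+1.
  have := truncnS_gt (8 / 3 * E); lra.
exists (maxn N 3); first by rewrite leq_max orbT.
move=> n; rewrite geq_max => /andP[Nn n3]; have {}NE : E <= 3 / 8 * n%:R.
  by apply: le_trans NE _; rewrite ler_wpM2l ?ler_nat //; lra.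
have [e1 e2 e3] := ode n.
(* The end terms [j = 0] and [j = n] involve the index [n] itself, with the fixed factor [x 0]; they
   go into the linear part, and the sum that is left runs over smaller indices. *)
have conv (g : nat -> {poly R[i]}) : (forall k, pnorm 4 (g k) <= x k) ->
    pnorm 4 (\sum_(j < n.+1) p j * g (n - j)%N) <=
    x 0%N * pnorm 4 (g n) + x 0%N * pnorm 4 (p n) +
    \sum_(1 <= j < n) x j * x (n - j)%N.
  move=> gx; rewrite -(big_mkord xpredT (fun j => p j * g (n - j)%N)).
  rewrite big_ltn // subn0 big_nat_recr /=; last by lia.
  rewrite subnn; apply: le_trans (pnormD _ _ w0) _.
  rewrite -addrA; apply: lerD.
    by apply: le_trans (pnormM _ _ w0) _; rewrite ler_wpM2r ?pnorm_ge0.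
  apply: le_trans (pnormD _ _ w0) _; rewrite [leLHS]addrC; apply: lerD.
    by apply: le_trans (pnormM _ _ w0) _; rewrite mulrC ler_wpM2r ?pnorm_ge0.
  apply: le_trans (pnorm_sum _ _ w0) _; apply: ler_sum => j _.
  by apply: le_trans (pnormM _ _ w0) _; rewrite ler_pM ?pnorm_ge0.
have := pnorm_ode (sp n) e1; have := pnorm_ode (sq n) e2; have := pnorm_ode (sr n) e3.
have := conv _ qx; have := conv _ rx; set S := \sum_(1 <= j < n) _.
set S1 := \sum_(j < n.+1) _; set S2 := \sum_(j < n.+1) _ => cr cq.
have nm1 : nm 1 = 1 := Normc.normc1 _.
have nm2 : nm 2 = 2 := normc_natr 2.
have nm83 : nm (- (8 / 3)) = 8 / 3.
  by rewrite normcN Normc.normcM Normc.normcV !normc_natr.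
have f1 : pnorm 4 (10 *: (q n - delay 1 p n)) <= 10 * (pnorm 4 (q n) + x n.-1).
  rewrite pnormZ normc_natr ler_wpM2l //; apply: le_trans (pnormD _ _ w0) _.
  by rewrite pnormN lerD2l (le_trans (pnorm_delay _ _ _)) // subn1.
have f2 : pnorm 4 (28 *: delay 2 p n - delay 1 q n - S1) <=
    28 * x n.-2 + x n.-1 + pnorm 4 S1.
  apply: le_trans (pnormD _ _ w0) _; rewrite pnormN lerD2r.
  apply: le_trans (pnormD _ _ w0) _; rewrite pnormN pnormZ normc_natr lerD //.
    by rewrite ler_wpM2l // (le_trans (pnorm_delay _ _ _)) // subn2.
  by rewrite (le_trans (pnorm_delay _ _ _)) // subn1.
have f3 : pnorm 4 (- (8 / 3) *: delay 1 r n + S2) <= 8 / 3 * x n.-1 + pnorm 4 S2.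
  apply: le_trans (pnormD _ _ w0) _; rewrite pnormZ nm83 lerD2r ler_wpM2l //.
  by rewrite (le_trans (pnorm_delay _ _ _)) // subn1.
rewrite nm1 nm2 => g3 g2 g1.
have S0 : 0 <= S by rewrite sumr_ge0 // => j _; rewrite mulr_ge0.
apply: (growth_step _ _ _ _ _ _ _ NE (le_trans g1 _) (le_trans g2 _)
  (le_trans g3 _)) => //.
- by rewrite !lerD2r; exact: f1.
- by rewrite !lerD2r (le_trans f2) // lerD2l; exact: cr.
- by rewrite !lerD2r (le_trans f3) // lerD2l; exact: cq.
Qed.

End FormalSolutions.

(** * The first terms of the recursion *)

Section InitialTerms.
Context {R : realType}.
Local Notation I := ('i%C : R[i]).
Local Notation frac := Defs.frac.

(** Reduces identities of polynomials to identities of values, which [field] can decide: a nonzero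
    difference would vanish at more natural numbers than its degree allows. *)
Lemma poly_horner_ext (p q : {poly R[i]}) : (forall x, p.[x] = q.[x]) -> p = q.
Proof.
move=> pq; apply/eqP; rewrite -subr_eq0; apply/negPn/negP => d0.
have := @max_poly_roots _ (p - q) [seq k%:R | k <- iota 0 (size (p - q))] d0.
rewrite size_map size_iota ltnn => H.
suff : false by []; apply: H.
  by apply/allP => x _; rewrite rootE hornerD hornerN pq subrr.
by rewrite map_inj_uniq ?iota_uniq // => a b /eqP; rewrite eqr_nat => /eqP.
Qed.

Implicit Types (t : R[i] * R[i] * R[i]) (p q r : nat -> R[i] * R[i] * R[i]).

Definition quad t : {poly R[i]} := t.1.1%:P + t.1.2 *: 'X + t.2 *: 'X^2.

Definition quad_val t (x : R[i]) := t.1.1 + t.1.2 * x + t.2 * x ^+ 2.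

Lemma horner_quad t x : (quad t).[x] = quad_val t x.
Proof. by rewrite /quad !hornerD !hornerZ hornerC hornerX hornerXn. Qed.

Lemma horner_deriv_quad t x : (quad t)^`().[x] = t.1.2 + 2 * t.2 * x.
Proof.
rewrite /quad !derivD !derivZ derivC derivX derivXn expr1 !hornerD !hornerZ.
by rewrite hornerMn horner0 hornerX -polyC1 hornerC -mulr_natl; ring.
Qed.

Lemma size_quad t n : ((n <= 0)%N -> t.1.1 = 0) -> ((n <= 1)%N -> t.1.2 = 0) ->
  ((n <= 2)%N -> t.2 = 0) -> (size (quad t) <= n)%N.
Proof.
move=> t1 t2 t3; apply/leq_sizeP => j nj.
rewrite /quad !coefD coefC !coefZ coefX coefXn.
case: j nj => [|[|[|j]]] /= nj; rewrite ?(mulr0, mulr1, addr0, add0r); auto.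
Qed.

Lemma horner_delay k (f : nat -> {poly R[i]}) n x :
  (delay k f n).[x] = delay k (fun j => (f j).[x]) n.
Proof. by rewrite /delay; case: ifP => // _; rewrite horner0. Qed.

(* The coefficients of P and Q are purely imaginary and those of R real (for real D), so
   that the factor I drops out. *)
Lemma formal_quad p q r n :
  (forall x, [/\ (p n).1.2 + 2 * (p n).2 * x + (n%:R - 1) * quad_val (p n) x =
        10 * (quad_val (q n) x - delay 1 (fun j => quad_val (p j) x) n),
      (q n).1.2 + 2 * (q n).2 * x + (n%:R - 2) * quad_val (q n) x =
        28 * delay 2 (fun j => quad_val (p j) x) n - delay 1 (fun j => quad_val (q j) x) n
        - \sum_(0 <= j < n.+1) quad_val (p j) x * quad_val (r (n - j)%N) x
    & (r n).1.2 + 2 * (r n).2 * x + (n%:R - 2) * quad_val (r n) x =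
        - (8 / 3) * delay 1 (fun j => quad_val (r j) x) n
        - \sum_(0 <= j < n.+1) quad_val (p j) x * quad_val (q (n - j)%N) x]) ->
  let P j := I *: quad (p j) in let Q j := I *: quad (q j) in let R_ j := quad (r j) in
  [/\ (P n)^`() + (n%:R - 1) *: P n = 10 *: (Q n - delay 1 P n),
      (Q n)^`() + (n%:R - 2) *: Q n = 28 *: delay 2 P n - delay 1 Q n
         - \sum_(j < n.+1) P j * R_ (n - j)%N
    & (R_ n)^`() + (n%:R - 2) *: R_ n = - (8 / 3) *: delay 1 R_ n
         + \sum_(j < n.+1) P j * Q (n - j)%N].
Proof.
move=> H P Q R_.
have dI k (f : nat -> {poly R[i]}) x :
    (delay k (fun j => I *: f j) n).[x] = I * delay k (fun j => (f j).[x]) n.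
  by rewrite horner_delay /delay; case: ifP; rewrite ?mulr0 ?hornerZ.
have hq (f : nat -> R[i] * R[i] * R[i]) x :
  (fun j => (quad (f j)).[x]) = (fun j => quad_val (f j) x).
  by apply/funext => j; rewrite horner_quad.
split; apply: poly_horner_ext => x; have [H1 H2 H3] := H x.
- rewrite /P /Q derivZ !(horner_deriv_quad, horner_quad, hornerD, hornerN, hornerZ) dI.
  by rewrite hq -mulrBr mulrCA -mulrDr H1 mulrCA.
- rewrite /P /Q derivZ !(horner_deriv_quad, horner_quad, hornerD, hornerN, hornerZ).
  have -> : (\sum_(j < n.+1) (I *: quad (p j)) * R_ (n - j)%N).[x] =
      I * \sum_(0 <= j < n.+1) quad_val (p j) x * quad_val (r (n - j)%N) x.
    rewrite horner_sum mulr_sumr big_mkord; apply: eq_bigr => j _.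
    by rewrite hornerM hornerZ !horner_quad mulrA.
  by rewrite !dI !hq [X in _ + X]mulrCA -mulrDr H2; ring.
- rewrite /P /Q /R_ !(horner_deriv_quad, horner_quad, hornerD, hornerZ) horner_delay hq H3.
  congr (_ + _); rewrite horner_sum -sumrN big_mkord; apply: eq_bigr => j _.
  by rewrite hornerM !hornerZ !horner_quad mulrACA -expr2 sqr_i mulN1r.
Qed.

Section Shapes.
Variables a b c d : R[i].
(** One lemma for each shape in which an initial polynomial is written, so that matching never looks
    into the literals. *)
Lemma quadC : a%:P = quad (a, 0, 0).
Proof. by rewrite /quad !scale0r !addr0. Qed.
Lemma quadZX : b *: 'X = quad (0, b, 0).
Proof. by rewrite /quad scale0r addr0 add0r. Qed.
Lemma quadCBX : a%:P - b *: 'X = quad (a, - b, 0).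
Proof. by rewrite /quad scale0r addr0 scaleNr. Qed.
Lemma quadNCDX : - a%:P + b *: 'X = quad (- a, b, 0).
Proof. by rewrite /quad scale0r addr0 polyCN. Qed.
Lemma quadNCBX : - a%:P - b *: 'X = quad (- a, - b, 0).
Proof. by rewrite /quad scale0r addr0 scaleNr polyCN. Qed.
Lemma quadCBX2 : a%:P - b *: 'X - c *: 'X^2 = quad (a, - b, - c).
Proof. by rewrite /quad !scaleNr. Qed.
Lemma quadCBCX2 : a%:P - d%:P - b *: 'X - c *: 'X^2 = quad (a - d, - b, - c).
Proof. by rewrite /quad !scaleNr polyCB. Qed.
Lemma quadNCDCX2 : - a%:P + d%:P - b *: 'X - c *: 'X^2 = quad (- a + d, - b, - c).
Proof. by rewrite /quad !scaleNr polyCD polyCN. Qed.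
End Shapes.

Variable D : R[i].

(* Tables of coefficients: as [tabP 3] and the like are never unfolded while rewriting, no two
   of the large literals get compared by conversion. *)
Definition tabP (n : nat) : R[i] * R[i] * R[i] := match n with
  | 0 => (2, 0, 0)
  | 1 => (frac 71 9, 0, 0)
  | 2 => (0, - frac 9880 81, 0)
  | 3 => (- frac 2108195 972, frac 469300 243, 0)
  | 4 => (D, - frac 96356411 6561, - frac 2736760 6561)
  | _ => 0
  end.

Definition tabQ (n : nat) : R[i] * R[i] * R[i] := match n with
  | 0 => (- frac 1 5, 0, 0)
  | 1 => (2, 0, 0)
  | 2 => (- frac 349 81, - frac 988 81, 0)
  | 3 => (- frac 25991 108, frac 64220 243, 0)
  | 4 => (frac 3 10 * D - frac 477319147 131220, - frac 167831753 65610,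
          - frac 273676 2187)
  | _ => 0
  end.

Definition tabR (n : nat) : R[i] * R[i] * R[i] := match n with
  | 0 => (- frac 1 5, 0, 0)
  | 1 => (frac 17 9, 0, 0)
  | 2 => (frac 1385 54, - frac 988 81, 0)
  | 3 => (- frac 211189 972, frac 167960 729, 0)
  | 4 => (- (frac 1 5 * D) + frac 138959125 17496, - frac 58846039 32805,
          - frac 1444456 2187)
  | _ => 0
  end.

Lemma init_quad n : (n < 5)%N -> [/\ initP D (n%:Z - 1) = I *: quad (tabP n),
  initQ D (n%:Z - 2) = I *: quad (tabQ n) & initR D (n%:Z - 2) = quad (tabR n)].
Proof.
case: n => [|[|[|[|[|n]]]]] n5; last by move: n5.
- by split; [rewrite [LHS]/= quadC|rewrite [LHS]/= quadC|exact: quadC].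
- by split; [rewrite [LHS]/= quadC|rewrite [LHS]/= quadC|exact: quadC].
- by split; [rewrite [LHS]/= quadZX|rewrite [LHS]/= quadNCBX|exact: quadCBX].
- by split; [rewrite [LHS]/= quadNCDX|rewrite [LHS]/= quadNCDX|exact: quadNCDX].
by split; [rewrite [LHS]/= quadCBX2|rewrite [LHS]/= quadCBCX2|exact: quadNCDCX2].
Qed.

(** The order [n = 4] is the resonance [m = 2]: the equations hold for every [D] because [D]
    multiplies the kernel vector [(i, 3 i / 10, - 1 / 5)] of [mxA 2]. *)
Lemma formal_tables n : (n < 5)%N -> forall x,
  [/\ (tabP n).1.2 + 2 * (tabP n).2 * x + (n%:R - 1) * quad_val (tabP n) x =
        10 * (quad_val (tabQ n) x - delay 1 (fun j => quad_val (tabP j) x) n),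
      (tabQ n).1.2 + 2 * (tabQ n).2 * x + (n%:R - 2) * quad_val (tabQ n) x =
        28 * delay 2 (fun j => quad_val (tabP j) x) n
        - delay 1 (fun j => quad_val (tabQ j) x) n
        - \sum_(0 <= j < n.+1) quad_val (tabP j) x * quad_val (tabR (n - j)%N) x
    & (tabR n).1.2 + 2 * (tabR n).2 * x + (n%:R - 2) * quad_val (tabR n) x =
        - (8 / 3) * delay 1 (fun j => quad_val (tabR j) x) n
        - \sum_(0 <= j < n.+1) quad_val (tabP j) x * quad_val (tabQ (n - j)%N) x].
Proof.
case: n => [|[|[|[|[|n]]]]] n5 x; last by move: n5.
all: clear n5; split; rewrite ?big_mkord; rewrite ?big_ord_recr ?big_ord0 /=.
all: rewrite /delay /quad_val /= Defs.frac.unlock; cbv beta.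
all: by field.
Qed.

Lemma size_tables n : (n < 5)%N -> [/\ (size (quad (tabP n)) <= n./2.+1)%N,
  (size (quad (tabQ n)) <= n./2.+1)%N & (size (quad (tabR n)) <= n./2.+1)%N].
Proof.
case: n => [|[|[|[|[|n]]]]] n5; last by move: n5.
all: clear n5; split; apply: size_quad => n5.
all: first [by move: n5 | reflexivity].
Qed.

End InitialTerms.

(** * The recursion *)

Section Recursion.
Context {R : realType}.
Local Notation I := ('i%C : R[i]).

Lemma size_map_polyC_mulmx (B : 'M[R[i]]_3) (V : 'cV[{poly R[i]}]_3) d i k :
  (forall l, (size (V l 0%R) <= d)%N) ->
  (size ((map_mx polyC B *m map_mx (fun p => p^`(k)) V) i 0%R) <= d)%N.
Proof.
move=> Vd; apply/leq_sizeP => j dj; rewrite mxE coef_sum big1 // => l _.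
rewrite !mxE coefCM coef_derivn nth_default ?mul0rn ?mulr0 //.
by rewrite (leq_trans (Vd l)) // (leq_trans dj) // leq_addl.
Qed.

Lemma deriv_map_polyC_mulmx (B : 'M[R[i]]_3) (V : 'cV[{poly R[i]}]_3) :
  map_mx (@deriv _) (map_mx polyC B *m V) = map_mx polyC B *m map_mx (@deriv _) V.
Proof.
apply/matrixP => i j; rewrite !mxE raddf_sum /=; apply: eq_bigr => l _.
by rewrite !mxE derivM derivC mul0r add0r.
Qed.

(* The finite Neumann series of [d/du - A] applied to [F]. *)
Lemma neumann_ode (A : 'M[R[i]]_3) (F : 'cV[{poly R[i]}]_3) d : A \is a GRing.unit ->
  (forall l, (size (F l 0%R) <= d)%N) ->
  let X := - \sum_(0 <= j < d)
    map_mx polyC (A ^- j.+1) *m map_mx (fun p => p^`(j)) F in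
  map_mx (@deriv _) X = map_mx polyC A *m X + F.
Proof.
(* The sums for [X'] and [A X] differ by a shift of [G], so their difference telescopes to
   [G 0 - G d], and [G d] vanishes by the bound on the sizes. *)
move=> Au Fd X; pose G j := map_mx polyC (A ^- j) *m map_mx (fun p => p^`(j)) F.
have AG j : map_mx polyC A *m
    (map_mx polyC (A ^- j.+1) *m map_mx (fun p => p^`(j)) F) = G j.
  by rewrite mulmxA -map_mxM -[A *m _]/(A * _) exprSr invrM ?unitrX // mulVKr.
have dX : map_mx (@deriv _) X = - \sum_(0 <= j < d) G j.+1.
  rewrite /X raddfN raddf_sum /=; congr (- _); apply: eq_bigr => j _.
  rewrite deriv_map_polyC_mulmx; congr (_ *m _).
  by apply/matrixP => k l; rewrite !mxE derivnS.
rewrite dX /X mulmxN mulmx_sumr.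
under [X in _ = - X + _]eq_bigr do rewrite AG.
have G0 : G 0 = F.
  rewrite /G expr0 invr1 map_mx1 mul1mx; apply/matrixP => k l; by rewrite !mxE.
have Gd : G d = 0.
  rewrite /G; have -> : map_mx (fun p => p^`(d)) F = 0.
    apply/matrixP => k l; rewrite !mxE ord1; apply/polyP => j; rewrite coef0 coef_derivn.
    by rewrite nth_default ?mul0rn // (leq_trans (Fd k)) // leq_addr.
  by rewrite mulmx0.
have := telescope_sumr G (leq0n d); rewrite Gd G0 sumrB sub0r => /eqP.
by rewrite subr_eq => /eqP ->; rewrite opprD opprK addrC.
Qed.

Lemma mxA_unit m : (3 <= m)%N -> @mxA R m \is a GRing.unit.
Proof.
move=> m3; pose M : R[i] := m%:R.
have [m0 m2 m3'] : [/\ M != 0, M - 2 != 0 & M + 3 != 0].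
  have M2 : M - 2 = (m - 2)%:R by rewrite natrB //; lia.
  have M3 : M + 3 = (m + 3)%:R by rewrite natrD.
  by rewrite M2 M3 !pnatr_eq0; split; lia.
(* [d] is the determinant, the product of the eigenvalues [- m + 2], [- m] and [- m - 3]; [B] is the
   adjugate divided by [d]. *)
pose d := - (M * (M - 2) * (M + 3)).
pose B : 'M[R[i]]_3 := \matrix_(i, j) (nth [::]
  [:: [:: (M ^+ 2 - 4) / d; 10 * M / d; - 20 * I / d];
      [:: (M - 2) / 5 / d; M * (M + 1) / d; - 2 * I * (M + 1) / d];
      [:: - (M - 2) * I / 5 / d; 2 * I * M / d; (M * (M + 1) - 2) / d]] i)`_j.
suff : mxA m *m B = 1%:M by move=> /mulmx1_unit[].
apply/matrixP => i j; rewrite !mxE !big_ord_recl big_ord0 !mxE /=.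
have II : I ^+ 2 = -1 by rewrite sqr_i.
case: i => [[|[|[|//]]] ?]; case: j => [[|[|[|//]]] ?] /=.
1-3,6-8: by rewrite -?[1 *- m]/(- M) /d; field; rewrite m0 m2 m3'.
(* [field] does not know that [I ^+ 2 = -1]; in the three remaining entries the exact multiple of
   [I ^+ 2 + 1] is split off first. *)
- transitivity (0 + (I ^+ 2 + 1) * (2 * (M - 2) / (5 * d))).
    by rewrite -?[1 *- m]/(- M) /d; field; rewrite m0 m2 m3'.
  by rewrite II addNr mul0r addr0.
- transitivity (1 + (I ^+ 2 + 1) * (- 4 * M / d)).
    by rewrite -?[1 *- m]/(- M) /d; field; rewrite m0 m2 m3'.
  by rewrite II addNr mul0r addr0.
- transitivity (1 + (I ^+ 2 + 1) * (- 4 * M / d)).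
    by rewrite -?[1 *- m]/(- M) /d; field; rewrite m0 m2 m3'.
  by rewrite II addNr mul0r addr0.
Qed.
End Recursion.

(** * The psi coefficients as a formal solution *)

Section PsiCoefficients.
Context {R : realType}.
Local Notation I := ('i%C : R[i]).
Variable D : R[i].

Definition shiftP n := psiP D (n%:Z - 1).
Definition shiftQ n := psiQ D (n%:Z - 2).
Definition shiftR n := psiR D (n%:Z - 2).
Local Notation p := shiftP.
Local Notation q := shiftQ.
Local Notation r := shiftR.

(** [n < 5] is the range of the initial data: P up to index 3, Q and R up to index 2. *)
Lemma psi_init n : (n < 5)%N ->
  [/\ p n = I *: quad (tabP D n), q n = I *: quad (tabQ D n) & r n = quad (tabR D n)].
Proof.
move=> n5; have [EP EQ ER] := psi_coeffsE D 0; have [IP IQ IR] := init_quad D n5.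
by rewrite /p /q /r EP ?EQ ?ER ?IP ?IQ ?IR //; lia.
Qed.

Lemma shiftPE (m : nat) : psiP D m = p m.+1.
Proof. by congr psiP; lia. Qed.

Lemma shiftQE m j : (j <= m)%N -> psiQ D (m%:Z - j%:Z - 1) = q (m.+1 - j)%N.
Proof. by move=> jm; congr psiQ; lia. Qed.

Lemma shiftRE m j : (j <= m)%N -> psiR D (m%:Z - j%:Z - 1) = r (m.+1 - j)%N.
Proof. by move=> jm; congr psiR; lia. Qed.

Lemma colF_psi m :
  [/\ colF (psi_coeffs D) m 0 0 = - 10 * p m.+1,
      colF (psi_coeffs D) m 1 0 = 28 * p m - q m.+1
        - \sum_(j < m.+1) p j.+1 * r (m.+1 - j)%N
    & colF (psi_coeffs D) m 2 0 = - (8 / 3) *: r m.+1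
        + \sum_(j < m.+1) p j.+1 * q (m.+1 - j)%N].
Proof.
split; rewrite mxE /=; first by rewrite shiftPE.
- congr (_ - _ - _).
  rewrite big_mkord; apply: eq_bigr => -[j jm] _ /=.
  by rewrite shiftPE shiftRE // -ltnS.
- congr (_ *: _ + _).
  rewrite big_mkord; apply: eq_bigr => -[j jm] _ /=.
  by rewrite shiftPE shiftQE // -ltnS.
Qed.

Lemma psi_rec m : (3 <= m)%N ->
  [/\ p m.+2 = colX (psi_coeffs D) m 0 0, q m.+2 = colX (psi_coeffs D) m 1 0
    & r m.+2 = colX (psi_coeffs D) m 2 0].
Proof.
move=> /(psi_coeffs_rec D) [<- <- <-].
by split; [congr psiP|congr psiQ|congr psiR]; lia.
Qed.

(** Halves rounded down are superadditive, so the degrees at [j + 1] and [m + 1 - j] add up to at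
    most [(m + 2) / 2]. Hence the truncation in [colX] loses no derivative of [colF]. *)
Lemma size_colF m :
  (forall n, (n < m.+2)%N -> [/\ (size (p n) <= n./2.+1)%N,
    (size (q n) <= n./2.+1)%N & (size (r n) <= n./2.+1)%N]) ->
  forall l, (size (colF (psi_coeffs D) m l 0%R) <= ((m + 2) %/ 2).+1)%N.
Proof.
move=> H l; rewrite divn2 addn2; set d := (m.+2)./2.+1.
have [F0 F1 F2] := colF_psi m.
have sD (f g : {poly R[i]}) : (size f <= d)%N -> (size g <= d)%N -> (size (f + g)%R <= d)%N.
  by move=> fd gd; rewrite (leq_trans (size_polyD _ _)) // geq_max fd.
have sN (f : {poly R[i]}) : (size f <= d)%N -> (size (- f)%R <= d)%N by rewrite size_polyN.
have sZ (f : {poly R[i]}) c : (size f <= d)%N -> (size (c *: f)%R <= d)%N.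
  by apply: leq_trans; exact: size_scale_leq.
have sMn (f : {poly R[i]}) n : (size f <= d)%N -> (size (n%:R * f)%R <= d)%N.
  by move=> fd; rewrite mulr_natl -scaler_nat sZ.
have sS (f g : nat -> {poly R[i]}) :
  (forall n, (n < m.+2)%N -> (size (f n) <= n./2.+1)%N /\ (size (g n) <= n./2.+1)%N) ->
  (size (\sum_(j < m.+1) f j.+1 * g (m.+1 - j)%N)%R <= d)%N.
  move=> fg; apply: (leq_trans (size_sum _ _ _)); apply/bigmax_leqP => -[j jm] _ /=.
  have [f1 _] := fg j.+1 ltac:(lia); have [_ g1] := fg (m.+1 - j)%N ltac:(lia).
  apply: (leq_trans (size_polyMleq _ _)); rewrite /d.
  by move: f1 g1; move: (size _) (size _) => a b; lia.
have le_d n : (n < m.+2)%N -> (n./2.+1 <= d)%N by rewrite /d; lia.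
have [p1 q1 r1] := H m.+1 (leqnn _).
have [p0 _ _] := H m (leqnSn _).
have ps n : (n < m.+2)%N -> (size (p n) <= d)%N.
  by move=> nm; have [pn _ _] := H n nm; exact: leq_trans (le_d n nm).
have l1 := le_d _ (leqnn m.+2).
case: l => [[|[|[|//]]] i].
- have -> : Ordinal i = 0 by apply: val_inj.
  by rewrite F0 mulNr sN // sMn // ps.
- have -> : Ordinal i = 1 by apply: val_inj.
  rewrite F1; apply: (sD _ _); last first.
    by apply/sN/sS => n nm; have [] := H n nm.
  by apply: (sD _ _); [apply/sMn/ps|apply/sN/(leq_trans q1)].
- have -> : Ordinal i = 2 by apply: val_inj.
  rewrite F2; apply: (sD _ _); first by apply/sZ/(leq_trans r1).
  by apply: sS => n nm; have [] := H n nm.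
Qed.

Lemma psi_size n : [/\ (size (p n) <= n./2.+1)%N,
  (size (q n) <= n./2.+1)%N & (size (r n) <= n./2.+1)%N].
Proof.
have [k] := ubnP n; elim: k n => // k IH n; rewrite ltnS => nk.
have [n5|n5] := ltnP n 5.
  have [-> -> ->] := psi_init n5; have [s1 s2 s3] := size_tables D n5.
  split; last exact: s3.
    exact: leq_trans (size_scale_leq _ _) s1.
  exact: leq_trans (size_scale_leq _ _) s2.
have -> : n = (n - 2).+2 by lia.
have m3 : (3 <= n - 2)%N by lia.
have Fd := @size_colF (n - 2) (fun l ln => IH l ltac:(lia)).
have dE : ((n - 2 + 2) %/ 2).+1 = ((n - 2).+2)./2.+1 by rewrite divn2 addn2.
have sX l : (size (colX (psi_coeffs D) (n - 2) l 0%R) <= ((n - 2).+2)./2.+1)%N.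
  rewrite -dE /colX mxE summxE size_polyN.
  apply: (leq_trans (size_sum _ _ _)); apply/bigmax_leqP_seq => j _ _.
  exact: size_map_polyC_mulmx.
by have [-> -> ->] := psi_rec m3.
Qed.

Lemma psi_formal : formal_lorenz p q r.
Proof.
move=> n; have [n5|n5] := ltnP n 5.
  have := formal_quad (formal_tables D n5).
  have init j : (j <= n)%N -> [/\ p j = I *: quad (tabP D j), q j = I *: quad (tabQ D j)
    & r j = quad (tabR D j)] by move=> jn; apply: psi_init; lia.
  have [pn qn rn] := init n (leqnn n).
  have del (f g : nat -> {poly R[i]}) k : (forall j, (j <= n)%N -> f j = g j) ->
    delay k f n = delay k g n.
    by move=> fg; rewrite /delay; case: ifP => // _; apply: fg; exact: leq_subr.
  have conv (f f' g g' : nat -> {poly R[i]}) : (forall j, (j <= n)%N -> f j = f' j) ->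
      (forall j, (j <= n)%N -> g j = g' j) ->
      \sum_(j < n.+1) f j * g (n - j)%N = \sum_(j < n.+1) f' j * g' (n - j)%N.
    move=> ff gg; apply: eq_bigr => -[j jn] _ /=.
    by rewrite ff ?gg ?leq_subr // -ltnS.
  have pj j : (j <= n)%N -> p j = I *: quad (tabP D j) by case/init.
  have qj j : (j <= n)%N -> q j = I *: quad (tabQ D j) by case/init.
  have rj j : (j <= n)%N -> r j = quad (tabR D j) by case/init.
  rewrite /= -(del _ _ _ pj) -(del _ _ _ pj) -(del _ _ _ qj) -(del _ _ _ rj).
  rewrite -(conv _ _ _ _ pj rj) -(conv _ _ _ _ pj qj).
  by rewrite -pn -qn -rn.
have [m m3 ->] : exists2 m, (3 <= m)%N & n = m.+2 by exists (n - 2)%N; lia.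
have Fd := @size_colF m (fun l _ => psi_size l).
have := neumann_ode (mxA_unit m3) Fd; rewrite -/(colX (psi_coeffs D) m).
set X := colX _ _ => /matrixP ode.
have [F0 F1 F2] := colF_psi m.
have [X0 X1 X2] := psi_rec m3.
have [p0 q0 r0] := psi_init (isT : (0 < 5)%N).
have {}p0 : p 0 = (2 * I)%:P.
  by rewrite p0 /quad /= !scale0r !addr0 -mul_polyC -polyCM mulrC.
have {}q0 : q 0 = (- (I / 5))%:P.
  by rewrite q0 /quad /= !scale0r !addr0 -mul_polyC -polyCM Defs.frac.unlock mulrN div1r.
have {}r0 : r 0 = (- (1 / 5))%:P.
  by rewrite r0 /quad /= !scale0r !addr0 Defs.frac.unlock.
(* The factors [p 0], [q 0] and [r 0] of the end terms are, up to sign, entries of [mxA]; the rest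
   of the convolution is the one in [colF]. *)
have conv (g : nat -> {poly R[i]}) : \sum_(j < m.+3) p j * g (m.+2 - j)%N =
    p 0 * g m.+2 + \sum_(j < m.+1) p j.+1 * g (m.+1 - j)%N + p m.+2 * g 0.
  rewrite big_ord_recr /= big_ord_recl /= subnn subn0; congr (_ + _ + _).
have sum3 (f : 'I_3 -> {poly R[i]}) : \sum_j f j = f 0 + f 1 + f 2.
  rewrite !big_ord_recl big_ord0 addr0 addrA.
  by congr (_ + f _ + f _); apply: val_inj.
have row i : (X i 0)^`() = (mxA m i 0)%:P * X 0 0 + (mxA m i 1)%:P * X 1 0 +
    (mxA m i 2)%:P * X 2 0 + colF (psi_coeffs D) m i 0.
  by have := ode i 0; rewrite !mxE sum3 !mxE.
have := row 0; have := row 1; have := row 2.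
rewrite F0 F1 F2 -X0 -X1 -X2 !mxE /= => e2 e1 e0.
have nE : m.+2%:R = m%:R + 2 :> R[i] by rewrite -natrD addn2.
rewrite !conv /delay /= !subn1 !subn2 /= p0 q0 r0 e0 e1 e2.
rewrite -!mul_polyC -[1 *- m]/(- m%:R) nE; move: (m%:R : R[i]) => M.
by split; rewrite ?polyC0; ring.
Qed.

End PsiCoefficients.

(** * From formal to actual solutions *)

(** Applied once for [x] and twice for [y] and [z], to restore the negative powers of [t - t0]. *)
Lemma is_derive_inv_mul (K : numFieldType) (t t0 : K) (G : K -> K) (dG : K) :
  t != t0 -> is_derive t (1 : K) G dG ->
  is_derive t (1 : K) (fun t' => (t' - t0)^-1 * G t')
    ((t - t0)^-1 * dG - (t - t0) ^- 2 * G t).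
Proof.
move=> tt0 Gd; have s0 : t - t0 != 0 by rewrite subr_eq0.
have d1 : is_derive t (1 : K) (fun t' : K => t' - t0 : K) (1 : K).
  by have := is_deriveB (is_derive_id t (1 : K)) (is_derive_cst t0 t 1); rewrite subr0.
have [e1 v1] := d1.
have d2 : is_derive t (1 : K) (fun t' : K => (t' - t0)^-1 : K) (- (t - t0) ^- 2 : K).
  apply: DeriveDef.
    have e2 := @derivableV K K (fun t' : K => t' - t0) t 1 s0 e1; exact e2.
  by rewrite (@deriveV K K (fun t' : K => t' - t0) t 1 s0 e1) v1 /GRing.scale /= mulr1.
have := is_deriveM d2 Gd.
have -> : (t - t0)^-1 *: dG + G t *: (- (t - t0) ^- 2 : K) =
   (t - t0)^-1 * dG - (t - t0) ^- 2 * G t.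
  by rewrite /GRing.scale /= mulrN [G t * _]mulrC.
exact.
Qed.

Section LorenzSolution.
Context {R : realType}.
Local Notation nm := (@Normc.normc R).
Local Open Scope classical_set_scope.
Implicit Types (g p q r : nat -> {poly R[i]}) (u s : R[i]).

(** The crude degree bound [n] in place of [n / 2] is enough: raising the weight to [4 * L] costs
    [L ^+ n], which the smallness of [(nm s + rho) * (L * K)] absorbs. *)
Lemma growth_line_bounded g u s kap rho M K L :
  half_size g -> (forall n, pnorm 4 (g n) <= M * K ^+ n) -> 0 <= M -> 0 <= K ->
  0 <= kap -> 0 <= rho -> 1 <= L ->
  nm u + kap * rho <= 4 * L -> (nm s + rho) * (L * K) <= 1 / 8 ->
  line_bounded g u s kap rho M.
Proof.
move=> gs gK M0 K0 k0 r0 L1 uL sL n; have L0 : 0 <= L by apply: le_trans L1.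
have a0 : 0 <= nm u + kap * rho by rewrite addr_ge0 ?mulr_ge0 ?normc_ge0.
have b0 : 0 <= nm s + rho by rewrite addr_ge0 ?normc_ge0.
have h1 : pnorm (nm u + kap * rho) (g n) <= L ^+ n * (M * K ^+ n).
  apply: le_trans (le_pnorm _ a0 uL) _.
  apply: le_trans (pnorm_scale (n := n) _ L1 _) _ => //.
    by rewrite (leq_trans (gs n)) //; lia.
  by rewrite ler_wpM2l ?exprn_ge0.
apply: le_trans (ler_wpM2r (exprn_ge0 n b0) h1) _.
have -> : L ^+ n * (M * K ^+ n) * (nm s + rho) ^+ n = M * ((nm s + rho) * (L * K)) ^+ n.
  by rewrite !exprMn; ring.
by rewrite ler_wpM2l // lerXn2r ?nnegrE ?mulr_ge0 //; lra.
Qed.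

(** With [x = y ^+ 2] and [y <= 1], the logarithm is at most [2 / y] in modulus and the product at
    most [y * (c + 2) * K]. The value 1/12 is 1/8 divided by the factor 3/2 that the margin [rho]
    costs later. *)
Lemma small_log (c K : R) : 0 <= c -> 0 < K -> exists2 r : R, 0 < r &
  forall x, 0 < x <= r -> x * (c + `|ln x|) * K <= 1 / 12.
Proof.
move=> c0 K0; have c2 : 0 < c + 2 by lra.
pose y0 : R := Num.min 1 (1 / (12 * K * (c + 2))).
have y00 : 0 < y0 by rewrite lt_min ltr01 divr_gt0 ?mulr_gt0.
exists (y0 ^+ 2); first by rewrite exprn_gt0.
move=> x /andP[x0 xr]; have [y y_gt0 [yy0 ->]] : exists2 y, 0 < y & y <= y0 /\ x = y ^+ 2.
  exists (Num.sqrt x); first by rewrite sqrtr_gt0.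
  by rewrite sqr_sqrtr ?(ltW x0) // -(ger0_norm (ltW y00)) -sqrtr_sqr ler_wsqrtr.
have [y1 y2] : y <= 1 /\ y <= 1 / (12 * K * (c + 2)).
  by split; rewrite (le_trans yy0) // /y0 ge_min lexx ?orbT.
have lny : `|ln (y ^+ 2)| <= 2 / y.
  rewrite ler0_norm; last by apply: ln_le0; rewrite exprn_ile1 // ltW.
  have yV : 0 < y^-1 by rewrite invr_gt0.
  have := ltW (ln_sublinear yV); rewrite lnV ?posrE // lnXn // => h.
  by rewrite mulr2n opprD; lra.
apply: (@le_trans _ _ (y * (c + 2) * K)).
  rewrite ler_wpM2r ?(ltW K0) // {1}expr2 -mulrA ler_wpM2l ?(ltW y_gt0) // mulrDr.
  have h1 : y * `|ln (y ^+ 2)| <= 2 by rewrite mulrC -ler_pdivlMr.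
  have h2 : y * c <= c by rewrite ler_piMl.
  by lra.
move: y2; rewrite ler_pdivlMr ?mulr_gt0 // => y2.
rewrite ler_pdivlMr //; lra.
Qed.

Lemma cvg_series_delay k g u s (l : R[i]^o) :
  (series (fun n => (g n).[u] * s ^+ n) : (R[i]^o) ^nat) @ \oo --> l ->
  (series (fun n => (delay k g n).[u] * s ^+ n) : (R[i]^o) ^nat) @ \oo -->
    (s ^+ k * l : R[i]^o).
Proof.
move=> gl.
have h : (fun n => s ^+ k * series (fun n => (g n).[u] * s ^+ n) n : R[i]^o) @ \oo -->
    (s ^+ k * l : R[i]^o) by exact: (cvgMl_tmp (a := s ^+ k : R[i]) gl).
apply/cvgc_normcP => e e0; move/cvgc_normcP: h => /(_ e e0) [N _ HN].
exists (N + k)%N => // n /= Nn; have -> : n = (n - k + k)%N by lia.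
have := HN (n - k)%N ltac:(rewrite /=; lia).
have -> // : s ^+ k * series (fun n => (g n).[u] * s ^+ n) (n - k)%N =
  series (fun n => (delay k g n).[u] * s ^+ n) (n - k + k)%N.
rewrite /series /= !big_mkord addnC big_split_ord /= [X in X + _]big1 ?add0r.
  rewrite mulr_sumr; apply: eq_bigr => j _.
  by rewrite /delay ltnNge leq_addr /= addKn exprD mulrCA.
by move=> j _; rewrite /delay ltn_ord horner0 mul0r.
Qed.

Lemma psi_sumE (A : int -> {poly R[i]}) k g u s (l : R[i]^o) : s != 0 ->
  (forall n : nat, A (- k%:Z + n%:Z) = g n) ->
  (series (fun n => (g n).[u] * s ^+ n) : (R[i]^o) ^nat) @ \oo --> l ->
  psi_cvg A (- k%:Z) u s /\ psi_sum A (- k%:Z) u s = s ^- k * l.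
Proof.
move=> s0 Ag gl.
have E : series (psi_terms A (- k%:Z) u s) =
    (fun n => s ^- k * series (fun n => (g n).[u] * s ^+ n) n).
  apply/funext => n; rewrite /series /= mulr_sumr; apply: eq_bigr => j _.
  rewrite /psi_terms Ag expfzDr // -exprnP exprnN; ring.
have h : (fun n => s ^- k * series (fun n => (g n).[u] * s ^+ n) n : R[i]^o) @ \oo -->
    (s ^- k * l : R[i]^o) by exact: (cvgMl_tmp (a := s ^- k : R[i]) gl).
rewrite /psi_cvg /psi_sum E; split; first by apply/cvg_ex; exists (s ^- k * l : R[i]^o).
exact: (cvg_lim (@norm_hausdorff _ (R[i]^o)) h).
Qed.

(** The closed form needs convergence at [t'], which is known only near [t]. The margins of
    [line_bounded] provide it even on the boundary circle, where a neighbourhood leaves the closed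
    disc. *)
Lemma near_psi_sum (A : int -> {poly R[i]}) k g (f : R[i]^o -> R[i]^o)
    (t t0 : R[i]^o) kap rho M :
  t != t0 -> 0 < rho -> 0 < kap -> nm (t - t0)^-1 < kap ->
  is_derive t (1 : R[i]^o) f (t - t0)^-1 ->
  (forall n : nat, A (- k%:Z + n%:Z) = g n) ->
  line_bounded g (f t) (t - t0) kap rho M ->
  \forall t' \near t, (t' - t0) ^- k * poly_series g (f t') (t' - t0) =
    psi_sum A (- k%:Z) (f t') (t' - t0).
Proof.
move=> tt0 r0 k0 ck fd Ag H; set s := t - t0.
have s0 : 0 < nm s by rewrite normc_gt0 subr_eq0.
have fc : f @ t --> f t.
  apply: differentiable_continuous; apply/derivable1_diffP; by case: fd.
have kr : 0 < kap * rho by rewrite mulr_gt0.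
have n1 : \forall t' \near t, nm (f t - f t') < kap * rho.
  by move/(@cvgc_normcP _ _ (nbhs t)): fc => /(_ _ kr).
have nid (e : R) : 0 < e -> \forall t' \near t, nm (t - t') < e.
  by move=> e0; have /cvgc_normcP/(_ _ e0) := @cvg_id _ (nbhs t).
have n2 := nid _ r0; have n3 := nid _ s0.
near=> t'.
have h1 : nm (f t - f t') < kap * rho by near: t'; exact: n1.
have h2 : nm (t - t') < rho by near: t'; exact: n2.
have h3 : nm (t - t') < nm s by near: t'; exact: n3.
have s0' : t' - t0 != 0.
  apply: contraTneq h3 => /eqP; rewrite subr_eq0 => /eqP ->.
  by rewrite ltxx.
have Hh : line_bounded g (f t + (f t' - f t)) (t - t0 + (t' - t)) 0 0 M.
  apply: (line_bounded_shift r0 (ltW k0) _ _ H); first by rewrite normcB ltW.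
  by rewrite normcB ltW.
have fE : f t + (f t' - f t) = f t' by rewrite addrC subrK.
have tE : t - t0 + (t' - t) = t' - t0 by rewrite addrC addrA subrK.
rewrite fE tE in Hh.
exact: esym (psi_sumE s0' Ag (line_bounded_cvg (lexx 0) (lexx 0) Hh)).2.
Unshelve. all: by end_near. Qed.

Lemma conv_term p q u s n :
  (\sum_(k < n.+1) p k * q (n - k)%N).[u] * s ^+ n =
  \sum_(j < n.+1) (p j).[u] * s ^+ j * ((q (n - j)%N).[u] * s ^+ (n - j)).
Proof.
rewrite horner_sum mulr_suml; apply: eq_bigr => j _.
by rewrite hornerM mulrACA -exprD subnKC // -ltnS.
Qed.

Section PsiSumDerivative.
Variables (A : int -> {poly R[i]}) (g : nat -> {poly R[i]}) (f : R[i]^o -> R[i]^o).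
Variables (t t0 : R[i]^o) (kap rho M : R).
Hypotheses (tt0 : t != t0) (rho0 : 0 < rho) (kap0 : 0 < kap) (tk : nm (t - t0)^-1 < kap).
Hypothesis fd : is_derive t (1 : R[i]^o) f (t - t0)^-1.
Hypothesis gb : line_bounded g (f t) (t - t0) kap rho M.
Let G := poly_series g (f t) (t - t0).
Let E := poly_series (fun n => (g n)^`() + n%:R *: g n) (f t) (t - t0).

(** [E] is [t - t0] times the derivative of the series [G]; differentiating the prefactor subtracts
    one [G]. *)
Lemma is_derive_psi_sum1 : (forall n : nat, A (-1 + n%:Z) = g n) ->
  is_derive t (1 : R[i]^o) (fun t' : R[i]^o => psi_sum A (-1) (f t') (t' - t0))
    ((t - t0) ^- 2 * (E - G)).
Proof.
move=> Ag; have near := near_psi_sum tt0 rho0 kap0 tk fd Ag gb.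
apply: (near_eq_is_derive near).
have := is_derive_inv_mul tt0 (is_derive_poly_series tt0 rho0 tk fd gb).
by move/is_derive_eq; apply; rewrite -/E -/G mulrA -invfM -expr2 -mulrBr.
Qed.

Lemma is_derive_psi_sum2 : (forall n : nat, A (-2 + n%:Z) = g n) ->
  is_derive t (1 : R[i]^o) (fun t' : R[i]^o => psi_sum A (-2) (f t') (t' - t0))
    ((t - t0) ^- 3 * (E - 2 * G)).
Proof.
move=> Ag; have near := near_psi_sum tt0 rho0 kap0 tk fd Ag gb.
have s0 : t - t0 != 0 by rewrite subr_eq0.
apply: (near_eq_is_derive near).
have := is_derive_inv_mul tt0
  (is_derive_inv_mul tt0 (is_derive_poly_series tt0 rho0 tk fd gb)).
rewrite -/E -/G; have -> : (fun t' : R[i] => (t' - t0)^-1 *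
    ((t' - t0)^-1 * poly_series g (f t') (t' - t0))) =
    (fun t' => (t' - t0) ^- 2 * poly_series g (f t') (t' - t0)).
  by apply/funext => t'; rewrite mulrA -invfM -expr2.
move/is_derive_eq; apply.
by field.
Qed.

End PsiSumDerivative.

(* Index [n] stands for the powers [n - 1] of [t - t0] in x and [n - 2] in y and z. *)
Lemma psi_lorenz_of_formal (c : coeffs R) p q r (C : R[i]) :
  (forall n : nat, coefP c (-1 + n%:Z) = p n) ->
  (forall n : nat, coefQ c (-2 + n%:Z) = q n) ->
  (forall n : nat, coefR c (-2 + n%:Z) = r n) ->
  formal_lorenz p q r -> half_size p -> half_size q -> half_size r ->
  exists2 e : R, 0 < e & forall t0 b : R[i], `|b| = 1 -> psi_lorenz C t0 b e c.
Proof.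
move=> cP cQ cR ode sp sq sr.
have [[M K] /= [M0 K1] growth] := formal_lorenz_growth ode sp sq sr.
have K0 : 0 < K by apply: lt_le_trans K1.
have c0 : 0 <= 1 + nm C + pi by have := normc_ge0 C; have := pi_ge0 R; lra.
have [e e0 small] := small_log c0 K0.
exists e => // t0 b b1 /=.
have nb : nm b = 1 by apply: complexI; rewrite -normcE_normc b1.
have b0 : b != 0 by rewrite -normc_gt0 nb.
pose f (t : R[i]^o) : R[i]^o := clog (b * (t - t0)) + C.
pose S := slit_disc t0 b e.
have St (t : R[i]^o) : S t -> [/\ t - t0 != 0, 0 < nm (t - t0) <= e
    & 0 < nm (b * (t - t0)) + complex.Re (b * (t - t0))].
  move=> [[te tt0] tb].
  have s0 : t - t0 != 0 by rewrite subr_eq0; apply/eqP.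
  split=> //; first by rewrite normc_gt0 s0 -lecR -normcE_normc.
  (* If [nm z + Re z <= 0], then [z] is minus its modulus, and multiplying by the conjugate of [b]
     puts [t] on the deleted ray. *)
  rewrite ltNge; apply/negP => neg; apply: tb; set z := b * (t - t0) in neg.
  have Rez : complex.Re z = - nm z.
    by have := ge_normc_Re z; rewrite ler_norml => /andP[? _]; apply/eqP; rewrite eq_le; lra.
  have Imz : complex.Im z = 0.
    apply/eqP; rewrite -sqrf_eq0; apply/eqP.
    by have := normc_sqr z; rewrite Rez sqrrN -[LHS]addr0 => /addrI.
  have zE : z = - (nm z)%:C%C.
    by apply/eqP; rewrite eq_complex Rez Imz; apply/andP; rewrite /= oppr0.
  exists (nm z); first exact: normc_ge0.
  have bb : b^*%C * b = 1 by rewrite mulrC -sqr_normc b1 expr1n.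
  by rewrite -mulrN -zE /z mulrA bb mul1r addrC subrK.
(* With [kap * rho = 1], the margin in [u] is 1 and that in [s] is half its modulus, while [kap] is
   twice [nm s^-1]. *)
have main (t : R[i]^o) : S t -> let s := t - t0 in let kap := 2 / nm s in
  let rho := nm s / 2 in [/\ 0 < kap, 0 < rho, nm s^-1 < kap,
   is_derive t (1 : R[i]^o) f s^-1 &
   forall g, half_size g -> (forall n, pnorm 4 (g n) <= M * K ^+ n) ->
     line_bounded g (f t) s kap rho M].
  move=> /St [s0 /andP[n0 ne] slit] s kap rho.
  have kap0 : 0 < kap by rewrite divr_gt0.
  have rho0 : 0 < rho by rewrite divr_gt0.
  split=> //.
  - by rewrite Normc.normcV /kap -[ltLHS]mul1r ltr_pM2r ?invr_gt0 //; lra.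
  - exact: is_derive_clog.
  move=> g gs gK; pose L := 1 + nm C + pi + `|ln (nm s)|.
  have L1 : 1 <= L.
    by have := normc_ge0 C; have := pi_ge0 R; have := normr_ge0 (ln (nm s)); rewrite /L; lra.
  apply: (growth_line_bounded (L := L) gs gK M0 (ltW K0) (ltW kap0) (ltW rho0) L1).
    have -> : kap * rho = 1 by rewrite /kap /rho; field; rewrite gt_eqF.
    have : nm (f t) <= L.
      apply: le_trans (le_normcD _ _) _.
      have := normc_clog (b * s); rewrite Normc.normcM nb mul1r.
      by rewrite /L; lra.
    by lra.
  have := small (nm s); rewrite n0 ne => /(_ isT).
  have -> : (nm s + rho) * (L * K) = 3 / 2 * (nm s * L * K) by rewrite /rho; field.
  by rewrite -/L; lra.
have gp n : pnorm 4 (p n) <= M * K ^+ n by have [] := growth n.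
have gq n : pnorm 4 (q n) <= M * K ^+ n by have [] := growth n.
have gr n : pnorm 4 (r n) <= M * K ^+ n by have [] := growth n.
split.
- move=> t tS; have [k0 r0 _ _ lb] := main t tS; have [s0 _ _] := St t tS.
  exact: (psi_sumE s0 cP (line_bounded_cvg (ltW r0) (ltW k0) (lb p sp gp))).1.
- move=> t tS; have [k0 r0 _ _ lb] := main t tS; have [s0 _ _] := St t tS.
  exact: (psi_sumE s0 cQ (line_bounded_cvg (ltW r0) (ltW k0) (lb q sq gq))).1.
- move=> t tS; have [k0 r0 _ _ lb] := main t tS; have [s0 _ _] := St t tS.
  exact: (psi_sumE s0 cR (line_bounded_cvg (ltW r0) (ltW k0) (lb r sr gr))).1.
move=> t tS; have [k0 r0 sk fd lb] := main t tS; have [s0 _ _] := St t tS.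
have tt0 : t != t0 by rewrite -subr_eq0.
have [lp lq lr] := And3 (lb p sp gp) (lb q sq gq) (lb r sr gr).
have cX := line_bounded_cvg (ltW r0) (ltW k0) lp.
have cY := line_bounded_cvg (ltW r0) (ltW k0) lq.
have cZ := line_bounded_cvg (ltW r0) (ltW k0) lr.
have [bX bY bZ] := And3 (line_bounded_geo (ltW r0) (ltW k0) lp)
  (line_bounded_geo (ltW r0) (ltW k0) lq) (line_bounded_geo (ltW r0) (ltW k0) lr).
have xE := (psi_sumE s0 cP cX).2; have yE := (psi_sumE s0 cQ cY).2.
have zE := (psi_sumE s0 cR cZ).2.
have dX := is_derive_psi_sum1 tt0 r0 k0 sk fd lp cP.
have dY := is_derive_psi_sum2 tt0 r0 k0 sk fd lq cQ.
have dZ := is_derive_psi_sum2 tt0 r0 k0 sk fd lr cR.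
move: xE yE zE dX dY dZ cX cY cZ bX bY bZ => /=.
set u := f t; set s := t - t0; rewrite -/f.
set X := poly_series p u s; set Y := poly_series q u s; set Z := poly_series r u s.
move=> xE yE zE dX dY dZ cX cY cZ bX bY bZ.
have c1X := cvg_series_delay (k := 1) cX; have c2X := cvg_series_delay (k := 2) cX.
have c1Y := cvg_series_delay (k := 1) cY; have c1Z := cvg_series_delay (k := 1) cZ.
have cXZ := cauchy_product bX bZ cX cZ; have cXY := cauchy_product bX bY cX cY.
(* The shift [n - 1] in the formal equation becomes the extra summand [X], as [n - 2] below gives
   [2 * Y] and [2 * Z]; these cancel against the terms from differentiating the prefactors. *)
have EX : poly_series (fun n => (p n)^`() + n%:R *: p n) u s = X + 10 * (Y - s * X).
  apply: (cvg_lim (@norm_hausdorff _ (R[i]^o))).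
  set F := series _; have -> : F = (fun n => series (fun n => (p n).[u] * s ^+ n) n +
      10 * (series (fun n => (q n).[u] * s ^+ n) n -
            series (fun n => (delay 1 p n).[u] * s ^+ n) n)).
    apply/funext => n; rewrite /F /series /= -sumrB mulr_sumr -big_split /=.
    apply: eq_bigr => j _; have [e1 _ _] := ode j.
    have -> : (p j)^`() + j%:R *: p j = p j + 10 *: (q j - delay 1 p j).
      by rewrite -e1 scalerBl scale1r addrCA [p j + _]addrC subrK.
    rewrite hornerD hornerZ hornerD hornerN; ring.
  exact: (cvgD cX (cvgMl_tmp (a := 10 : R[i]) (cvgB cY c1X))).
have EY : poly_series (fun n => (q n)^`() + n%:R *: q n) u s =
    2 * Y + (28 * (s ^+ 2 * X) - s * Y - X * Z).
  apply: (cvg_lim (@norm_hausdorff _ (R[i]^o))).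
  set F := series _; have -> : F = (fun n => 2 * series (fun n => (q n).[u] * s ^+ n) n +
      (28 * series (fun n => (delay 2 p n).[u] * s ^+ n) n -
       series (fun n => (delay 1 q n).[u] * s ^+ n) n -
       series (fun n => \sum_(j < n.+1) (p j).[u] * s ^+ j *
         ((r (n - j)%N).[u] * s ^+ (n - j))) n)).
    apply/funext => n; rewrite /F /series /= !mulr_sumr -!sumrB -big_split /=.
    apply: eq_bigr => j _; have [_ e2 _] := ode j.
    have -> : (q j)^`() + j%:R *: q j = 2 *: q j + (28 *: delay 2 p j - delay 1 q j
         - \sum_(k < j.+1) p k * r (j - k)%N).
      by rewrite -e2 scalerBl addrCA [2 *: q j + _]addrC subrK.
    rewrite -conv_term !hornerD !hornerN !hornerZ; ring.
  exact: (cvgD (cvgMl_tmp (a := 2 : R[i]) cY)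
    (cvgB (cvgB (cvgMl_tmp (a := 28 : R[i]) c2X) c1Y) cXZ)).
have EZ : poly_series (fun n => (r n)^`() + n%:R *: r n) u s =
    2 * Z + (- (8 / 3) * (s * Z) + X * Y).
  apply: (cvg_lim (@norm_hausdorff _ (R[i]^o))).
  set F := series _; have -> : F = (fun n => 2 * series (fun n => (r n).[u] * s ^+ n) n +
      (- (8 / 3) * series (fun n => (delay 1 r n).[u] * s ^+ n) n +
       series (fun n => \sum_(j < n.+1) (p j).[u] * s ^+ j *
         ((q (n - j)%N).[u] * s ^+ (n - j))) n)).
    apply/funext => n; rewrite /F /series /= !mulr_sumr -!big_split /=.
    apply: eq_bigr => j _; have [_ _ e3] := ode j.
    have -> : (r j)^`() + j%:R *: r j = 2 *: r j + (- (8 / 3) *: delay 1 r j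
         + \sum_(k < j.+1) p k * q (j - k)%N).
      by rewrite -e3 scalerBl addrCA [2 *: r j + _]addrC subrK.
    rewrite -conv_term !hornerD !hornerZ; ring.
  exact: (cvgD (cvgMl_tmp (a := 2 : R[i]) cZ)
    (cvgD (cvgMl_tmp (a := - (8 / 3) : R[i]) c1Z) cXY)).
rewrite EX in dX; rewrite EY in dY; rewrite EZ in dZ.
rewrite /= xE yE zE.
split.
- by apply: is_derive_eq dX _; field.
- by apply: is_derive_eq dY _; field.
- by apply: is_derive_eq dZ _; field.
Qed.

End LorenzSolution.

(** This is the invariance of the Lorenz system under [(x, y, z) -> (- x, - y, z)]. *)
Lemma formal_lorenz_opp (R : realType) (p q r : nat -> {poly R[i]}) :
  formal_lorenz p q r -> formal_lorenz (fun n => - p n) (fun n => - q n) r.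
Proof.
move=> ode n; have [e1 e2 e3] := ode n.
have dN k (f : nat -> {poly R[i]}) : delay k (fun n => - f n) n = - delay k f n.
  by rewrite /delay; case: ifP; rewrite ?oppr0.
split; rewrite ?dN ?derivN ?scalerN -?opprD.
- by rewrite e1 scalerN.
- have -> : \sum_(j < n.+1) - p j * r (n - j)%N = - \sum_(j < n.+1) p j * r (n - j)%N.
    by rewrite -sumrN; apply: eq_bigr => j _; rewrite mulNr.
  by rewrite e2; ring.
- by rewrite e3; congr (_ + _); apply: eq_bigr => j _; rewrite mulrNN.
Qed.

Unset Implicit Arguments.

Theorem theorem1p1 (R : realType) (C D : R[i]) :
  (exists2 r : R, 0 < r & forall t0 b : R[i], `|b| = 1 ->
     psi_lorenz C t0 b r (psi_coeffs D)) /\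
  (exists2 r : R, 0 < r & forall t0 b : R[i], `|b| = 1 ->
     psi_lorenz C t0 b r (flip_sign (psi_coeffs D))).
Proof.
have ode := psi_formal D.
have sp : half_size (shiftP D) by move=> n; have [] := psi_size D n.
have sq : half_size (shiftQ D) by move=> n; have [] := psi_size D n.
have sr : half_size (shiftR D) by move=> n; have [] := psi_size D n.
have cP n : psiP D (-1 + n%:Z) = shiftP D n by rewrite addrC.
have cQ n : psiQ D (-2 + n%:Z) = shiftQ D n by rewrite addrC.
have cR n : psiR D (-2 + n%:Z) = shiftR D n by rewrite addrC.
split; first exact: (psi_lorenz_of_formal (c := psi_coeffs D) C cP cQ cR ode).
have cNP n : - psiP D (-1 + n%:Z) = - shiftP D n by rewrite cP.
have cNQ n : - psiQ D (-2 + n%:Z) = - shiftQ D n by rewrite cQ.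
apply: (psi_lorenz_of_formal (c := flip_sign (psi_coeffs D)) C cNP cNQ cR
  (formal_lorenz_opp ode)) => // n;
  by rewrite size_polyN.
Qed.
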